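(* Consider the triangular array $Y_{n,k}=\mu+\delta_n\mathbf{1}\{k>\tau_n\}+\sigma(k/n)\varepsilon_k$, $k=1,\dots,n$, and suppose Assumptions E, V and C (stated in the context) hold. Under the alternative hypothesis $\mathcal{H}_1$ with $\tau_n=[n\zeta]$ for some $\zeta\in(0,1)$, the estimator $$\hat\tau_n=\operatorname{argmax}_{1\le k\le n}\frac{\left|\sum_{i=1}^k(Y_{n,i}-\bar Y_{n,1:n})\right|+\left|\sum_{i=n-k+1}^n(Y_{n,i}-\bar Y_{n,1:n})\right|}{\max_{1\le i\le k}\left|\sum_{j=1}^i(Y_{n,j}-\bar Y_{n,1:k})\right|+\max_{k<i\le n}\left|\sum_{j=i}^n(Y_{n,j}-\bar Y_{n,(k+1):n})\right|}$$ satisfies $\hat\tau_n/n\xrightarrow{P}\zeta$ as $n\to\infty$.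
   Context: Model: $Y_{n,k}=\mu+\delta_n\mathbf{1}\{k>\tau_n\}+\sigma(k/n)\varepsilon_k$, $k=1,\dots,n$, with unknown $\mu,\delta_n\in\mathbb{R}$, $\tau_n\in\{1,\dots,n\}$, strictly stationary centered $\{\varepsilon_k\}$, deterministic $\sigma:[0,1]\to(0,\infty)$. $\mathcal{H}_1:\tau_n<n,\ \delta_n\ne0$. $\bar Y_{n,i:j}=\frac1{j-i+1}\sum_{k=i}^jY_{n,k}$; $[x]$ is the integer part. Strong mixing coefficients: $\alpha(n)=\sup_k\sup_{A\in\sigma(\varepsilon_1,\dots,\varepsilon_k),B\in\sigma(\varepsilon_{k+n},\dots)}|P(A\cap B)-P(A)P(B)|$. Assumption E: $\{\varepsilon_n\}$ zero-mean strictly stationary $\alpha$-mixing, $\operatorname{Var}\varepsilon_n=1$, $E|\varepsilon_n|^p<\infty$ for some $p>2$, $\sum_n\alpha(n)^{2(1/r-1/p)}<\infty$ for some $r\in(2,4]$, $r\le p$, $\sum_nn\alpha(n)<\infty$, and $0<1+2\sum_{n\ge1}E\varepsilon_1\varepsilon_{n+1}<\infty$. Assumption V: $\sigma:[0,1]\to\mathbb{R}^+$ has finitely many discontinuity points and satisfies a first-order Lipschitz condition except at discontinuity points. Assumption C: $|\delta_n|\sqrt n\to\infty$. *)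

(* Defs.v *)
From HB Require Import structures.
From mathcomp Require Import all_boot all_order all_algebra.
From mathcomp Require Import all_classical all_reals all_analysis.
Set Implicit Arguments. Unset Strict Implicit. Unset Printing Implicit Defensive.
Import Order.TTheory GRing.Theory Num.Theory.
Import numFieldNormedType.Exports.
Local Open Scope classical_set_scope.
Local Open Scope ring_scope.

Section defs.
Context {d : measure_display} {T : measurableType d} {R : realType}.
Variable P : probability T R.

(* Convention: the paper's eps_k (k >= 1) is  e (k.-1)  here, i.e. e is the
   sequence (eps_1, eps_2, ...) indexed from 0. *)

Definition gen_sigma (e : nat -> T -> R) (I : set nat) : set (set T) :=
  <<s [set A | exists i, I i /\ exists B : set R, measurable B /\ A = e i @^-1` B] >>.

(* strict stationarity: all finite-dimensional distributions are shift
   invariant (stated on measurable rectangles, which determine them) *)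
Definition strictly_stationary (e : nat -> T -> R) : Prop :=
  forall (m h : nat) (B : nat -> set R), (forall i, measurable (B i)) ->
    P (\bigcap_(i in `I_m) (e i @^-1` B i)) =
    P (\bigcap_(i in `I_m) (e (i + h)%N @^-1` B i)).

(* strong mixing coefficient alpha(n):
   sup_k sup_{A in sigma(eps_1..eps_k), B in sigma(eps_{k+n},...)} |P(AB)-P(A)P(B)|
   (with k = j+1, 0-based indices: past i <= j, future i >= j + n) *)
Definition alpha_mix (e : nat -> T -> R) (n : nat) : R :=
  sup [set r : R | exists (j : nat) (A B : set T),
         gen_sigma e [set i | (i <= j)%N] A /\
         gen_sigma e [set i | (j + n <= i)%N] B /\
         r = `| fine (P (A `&` B)) - fine (P A) * fine (P B) | ].

Definition assumption_E (e : nat -> {RV P >-> R}) : Prop :=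
  strictly_stationary (fun k => e k) /\
  (forall k, ('E_P[e k] = 0)%E) /\
  (forall k, ('V_P[e k] = 1)%E) /\
  (exists p : R, 2 < p /\ ('E_P[fun w => (`|e 0%N w| `^ p)%R] < +oo)%E /\
     exists r : R, 2 < r /\ r <= 4 /\ r <= p /\
       cvg (series (fun n => alpha_mix (fun k => e k) n `^ (2 * (r^-1 - p^-1))) @ \oo)) /\
  cvg (series (fun n => n%:R * alpha_mix (fun k => e k) n) @ \oo) /\
  (* long-run variance: 0 < 1 + 2 sum_{n>=1} E eps_1 eps_{n+1} < oo *)
  (let c := fun n : nat => fine ('E_P[fun w => (e 0%N w * e n.+1 w)%R])%E in
   cvg (series c @ \oo) /\ 0 < 1 + 2 * lim (series c @ \oo)).

(* Assumption V: sigma : [0,1] -> (0,oo), with a finite set D of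
   (discontinuity) points outside of which it is (first-order) Lipschitz *)
Definition assumption_V (sigma : R -> R) : Prop :=
  (forall x, 0 <= x <= 1 -> 0 < sigma x) /\
  exists (D : seq R) (L : R),
    forall x y, 0 <= x <= 1 -> 0 <= y <= 1 ->
      (forall t, t \in D -> ~ (Num.min x y <= t <= Num.max x y)) ->
      `|sigma x - sigma y| <= L * `|x - y|.

Definition assumption_C (delta : nat -> R) : Prop :=
  (fun n => `|delta n| * Num.sqrt n%:R) @ \oo --> +oo.

Definition tau (zeta : R) (n : nat) : nat := Num.truncn (n%:R * zeta).

Definition Ymodel (mu : R) (delta : nat -> R) (zeta : R) (sigma : R -> R)
  (e : nat -> T -> R) (n k : nat) (w : T) : R :=
  mu + (if (tau zeta n < k)%N then delta n else 0) + sigma (k%:R / n%:R) * e k.-1 w.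

Definition Ybar (Y : nat -> R) (i j : nat) : R :=
  (\sum_(i <= l < j.+1) Y l) / (j.+1 - i)%:R.

Definition ratio_stat (Y : nat -> R) (n k : nat) : R :=
  (`| \sum_(1 <= i < k.+1) (Y i - Ybar Y 1 n) |
   + `| \sum_(n - k + 1 <= i < n.+1) (Y i - Ybar Y 1 n) |)
  / (\big[Num.max/0]_(1 <= i < k.+1) `| \sum_(1 <= j < i.+1) (Y j - Ybar Y 1 k) |
     + \big[Num.max/0]_(k.+1 <= i < n.+1) `| \sum_(i <= j < n.+1) (Y j - Ybar Y k.+1 n) |).

Definition argmax_seq (f : nat -> R) (s : seq nat) (d0 : nat) : nat :=
  foldl (fun best k => if f best < f k then k else best) d0 s.

(* hat tau_n = argmax_{1 <= k <= n} ratio (smallest maximiser) *)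
Definition tauhat (Y : nat -> R) (n : nat) : nat :=
  argmax_seq (ratio_stat Y n) (iota 2 n.-1) 1.

End defs.

(* Main.v *)
Require Import Defs.
From HB Require Import structures.
From mathcomp Require Import all_boot all_order all_algebra.
From mathcomp Require Import all_classical all_reals all_analysis.
From mathcomp Require Import measurable_realfun.
From mathcomp Require Import ring lra zify.
Set Implicit Arguments. Unset Strict Implicit. Unset Printing Implicit Defensive.
Import Order.TTheory GRing.Theory Num.Theory.
Import numFieldNormedType.Exports.
Local Open Scope classical_set_scope.
Local Open Scope ring_scope.

(* Write W_k for the partial sums of the noise sigma(k/n) eps_k. Off the change point the
   ratio is bounded: its denominator contains the tent-shaped drift left by the
   undetected change, of order |delta_n| n, like the numerator. At k = tau_n the
   denominator is pure noise, at most 6 max |W_k|, so the ratio explodes as soon as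
   max |W_k| = o(|delta_n| n) in probability and the denominator does not vanish.

   The denominator at tau_n vanishes only if sigma(k/n) eps_k is constant for k <= tau_n,
   so that all these eps_k have the same sign, which mixing makes asymptotically
   impossible for a centered nondegenerate sequence.

   Since only |delta_n| sqrt n -> oo is known, max |W_k| = O_P(sqrt n) is needed without
   any logarithm. Truncate eps at n^(1/16). By interpolating Davydov's covariance
   inequality, the variance of sums of the tails gains a power of n, which beats the
   log^2 of the Rademacher-Menshov inequality. For the bounded part, Ottaviani's argument
   on blocks of length about n^(3/8) costs (n / l) alpha(l) = o(1), and inside a block
   the trivial bound suffices. *)

(** * Expectation of real functions *)

(** Two facts shape the argument. Division by zero returns 0, so a vanishing denominator at the
    change point would make the statistic lose there instead of win; hence the separate proof of
    positivity. And the exponent [2 * (r^-1 - p^-1)] of the mixing series is strictly smaller than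
    Davydov's [1 - 2 / p]: the difference is a reserve, which the interpolation converts into a
    power of the second moment of the truncated tails.

    Origin of the exponents 1/16 and 3/8: alpha(l) = O(l^-2), so the block argument costs n / l^3
    and needs l well above n^(1/3), while the trivial bound l b inside a block must stay below sqrt
    n. With b = n^(1/16) and l = n^(6/16) the two conditions read 18/16 > 1 and 7/16 < 8/16. A small
    power of n suffices for b, since the gain on the tails only has to beat a squared logarithm.
    Working with n ~ 2^(16h) makes all these quantities powers of two. *)

Section expectation.
Context {d : measure_display} {T : measurableType d} {R : realType}.
Variable P : probability T R.

Local Notation E f := (Rintegral P setT f).
Local Notation integ f := (integrable P setT (EFin \o f)).
Local Notation pr A := (fine (P A)).
Local Notation mf f := (measurable_fun setT f).

Lemma pr_ge0 (A : set T) : 0 <= pr A.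
Proof. by rewrite fine_ge0. Qed.

Lemma pr_le (A B : set T) : measurable A -> measurable B -> A `<=` B ->
  pr A <= pr B.
Proof.
move=> mA mB AB; apply: fine_le; rewrite ?fin_num_measure//.
by apply: le_measure; rewrite ?inE.
Qed.

Lemma pr_le1 (A : set T) : measurable A -> pr A <= 1.
Proof.
move=> mA; rewrite -[leRHS]/(fine 1%:E) fine_le ?fin_num_measure//.
exact: probability_le1.
Qed.

Lemma pr_leU (A B : set T) : measurable A -> measurable B ->
  pr (A `|` B) <= pr A + pr B.
Proof.
move=> mA mB; rewrite -fineD ?fin_num_measure//.
apply: fine_le; rewrite ?fin_numD ?fin_num_measure//; last exact: measureU2.
exact: measurableU.
Qed.

Lemma pr_le_bigU (n : nat) (F : nat -> set T) :
  (forall i, measurable (F i)) ->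
  pr (\big[setU/set0]_(i < n) F i) <= \sum_(i < n) pr (F i).
Proof.
move=> mF; elim: n => [|n IH]; first by rewrite !big_ord0 measure0.
rewrite !big_ord_recr /=; apply: le_trans (lerD IH (lexx _)).
by apply: pr_leU => //; exact: bigsetU_measurable.
Qed.

Lemma pr_setD (A B : set T) : measurable A -> measurable B -> B `<=` A ->
  pr (A `\` B) = pr A - pr B.
Proof.
move=> mA mB BA; rewrite measureD//; last by rewrite ltey_eq fin_num_measure.
by rewrite setIidr// fineB ?fin_num_measure.
Qed.

Lemma E_indic (A : set T) : measurable A -> E (\1_A) = pr A.
Proof. by move=> mA; rewrite /Rintegral integral_indic// setIT. Qed.

Lemma integ_bounded (f : T -> R) (B : R) :
  mf f -> (forall w, `|f w| <= B) -> integ f.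
Proof.
move=> mf fB; apply: measurable_bounded_integrable => //.
  by rewrite ltey_eq fin_num_measure.
exists `|B|; split; first exact: num_real.
move=> M BM w _; apply: le_trans (fB w) _.
by apply: le_trans (ler_norm _) (ltW BM).
Qed.

Lemma integ_dom (f g : T -> R) : mf f -> integ g ->
  (forall w, `|f w| <= g w) -> integ f.
Proof.
move=> mf ig fg; apply: (le_integrable _ _ _ ig) => //.
  exact/measurable_EFinP.
by move=> w _ /=; rewrite lee_fin; apply: le_trans (fg w) (ler_norm _).
Qed.

Lemma integ_mf (f : T -> R) : integ f -> mf f.
Proof. by move=> /integrableP[/measurable_EFinP]. Qed.

Lemma integ_cst (c : R) : integ (fun _ => c).
Proof. by apply: (@integ_bounded _ `|c|). Qed.

Lemma integ_indic (A : set T) : measurable A -> integ (\1_A).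
Proof.
by move=> mA; exact: integrable_indic.
Qed.

Lemma integD (f g : T -> R) : integ f -> integ g -> integ (fun w => f w + g w).
Proof. by move=> i j; apply: eq_integrable (integrableD _ i j). Qed.

Lemma integB (f g : T -> R) : integ f -> integ g -> integ (fun w => f w - g w).
Proof. by move=> i j; apply: eq_integrable (integrableB _ i j). Qed.

Lemma integZ (c : R) (f : T -> R) : integ f -> integ (fun w => c * f w).
Proof. by move=> i; apply: eq_integrable (integrableZl _ c i). Qed.

Lemma integ_abs (f : T -> R) : integ f -> integ (fun w => `|f w|).
Proof. exact: integrable_norm. Qed.

Lemma integ_sum (I : Type) (s : seq I) (F : I -> T -> R) :
  (forall i, integ (F i)) -> integ (fun w => \sum_(i <- s) F i w).
Proof.
move=> iF; elim: s => [|i s IH].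
  by under eq_fun do rewrite big_nil; exact: integ_cst.
by under eq_fun do rewrite big_cons; exact: integD.
Qed.

Lemma E_cst (c : R) : E (fun _ => c) = c.
Proof.
have -> := Rintegral_cst P measurableT c.
rewrite -[RHS]mulr1; congr (_ * _).
exact: (congr1 fine (probability_setT P)).
Qed.

Lemma ED (f g : T -> R) : integ f -> integ g ->
  E (fun w => f w + g w) = E f + E g.
Proof. exact: RintegralD. Qed.

Lemma EB (f g : T -> R) : integ f -> integ g ->
  E (fun w => f w - g w) = E f - E g.
Proof. exact: RintegralB. Qed.

Lemma EZ (c : R) (f : T -> R) : integ f -> E (fun w => c * f w) = c * E f.
Proof. by move=> i; exact: RintegralZl. Qed.

Lemma E_sum (I : Type) (s : seq I) (F : I -> T -> R) :
  (forall i, integ (F i)) ->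
  E (fun w => \sum_(i <- s) F i w) = \sum_(i <- s) E (F i).
Proof.
move=> iF; elim: s => [|i s IH].
  by under eq_fun do rewrite big_nil; rewrite big_nil E_cst.
under eq_fun do rewrite big_cons.
by rewrite big_cons ED ?IH//; exact: integ_sum.
Qed.

Lemma E_le (f g : T -> R) : integ f -> integ g -> (forall w, f w <= g w) ->
  E f <= E g.
Proof. by move=> i j fg; exact: le_Rintegral. Qed.

Lemma E_ge0 (f : T -> R) : (forall w, 0 <= f w) -> 0 <= E f.
Proof. by move=> f0; exact: Rintegral_ge0. Qed.

Lemma E_abs_le (f g : T -> R) : integ f -> integ g ->
  (forall w, `|f w| <= g w) -> `|E f| <= E g.
Proof.
move=> i j fg; apply: le_trans (le_normr_Rintegral _ i) _ => //.
by apply: E_le => //; exact: integ_abs.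
Qed.

Lemma chebyshev_sqr (f : T -> R) (x : R) : mf f ->
  integ (fun w => f w ^+ 2) -> 0 < x ->
  pr [set w | x < `|f w|] <= E (fun w => f w ^+ 2) / x ^+ 2.
Proof.
move=> mf i x0.
have mA : measurable [set w | x < `|f w|].
  have m2 : measurable_fun setT (fun w => `|f w|) by exact: measurableT_comp.
  have := measurable_fun_ltr (measurable_cst x) m2.
  by move=> /(_ measurableT [set true] I); rewrite setTI; congr measurable.
rewrite ler_pdivlMr ?exprn_gt0// -E_indic// mulrC -EZ; last exact: integ_indic.
apply: E_le => //; first exact/integZ/integ_indic.
move=> w; rewrite indicE; have [|_] := boolP (w \in _); last by rewrite mulr0 sqr_ge0.
rewrite inE /= => xf; rewrite mulr1 -[leRHS]real_normK ?num_real//.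
by rewrite lerXn2r ?nnegrE// ltW.
Qed.

End expectation.

(** * Covariance of bounded functions *)

Section bounded_covariance.
Context {d : measure_display} {T : measurableType d} {R : realType}.
Variable P : probability T R.

Local Notation E f := (Rintegral P setT f).
Local Notation integ f := (integrable P setT (EFin \o f)).
Local Notation pr A := (fine (P A)).
Local Notation mf f := (measurable_fun setT f).

Lemma measurable_gt (f : T -> R) (x : R) : mf f -> measurable [set w | x < f w].
Proof.
move=> mf; have := measurable_fun_ltr (measurable_cst x) mf.
by move=> /(_ measurableT [set true] I); rewrite setTI; congr measurable.
Qed.

Lemma measurable_ge (f : T -> R) (x : R) : mf f -> measurable [set w | x <= f w].
Proof.
move=> mf; have := measurable_fun_ler (measurable_cst x) mf.
by move=> /(_ measurableT [set true] I); rewrite setTI; congr measurable.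
Qed.

(** Discrete layer cake: it turns an integer part into a sum of indicators of level sets. *)
Lemma sum_lev_nat (m k : nat) : (k <= m)%N ->
  \sum_(i < m) ((i.+1 <= k)%N%:R : R) = k%:R.
Proof.
elim: m k => [|m IH] k; first by rewrite leqn0 => /eqP ->; rewrite big_ord0.
rewrite leq_eqVlt => /predU1P[->|]; last first.
  rewrite ltnS => km; rewrite big_ord_recr /= IH//.
  by rewrite ltnNge km addr0.
rewrite (eq_bigr (fun=> 1)) ?sumr_const ?card_ord// => i _.
by rewrite ltn_ord.
Qed.

(** Covariance is bilinear, so it splits into [m ^ 2] covariances of indicators. *)
Lemma cov_discretized (a : R) (m : nat) (A B : nat -> set T) :
  (forall i, measurable (A i)) -> (forall i, measurable (B i)) ->
  (forall i j, `|pr (A i `&` B j) - pr (A i) * pr (B j)| <= a) ->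
  forall X Y : T -> R,
  X = (fun w => \sum_(i < m) \1_(A i) w) ->
  Y = (fun w => \sum_(i < m) \1_(B i) w) ->
  `|E (fun w => X w * Y w) - E X * E Y| <= m%:R ^+ 2 * a.
Proof.
move=> mA mB ab X Y XE YE.
have EX : E X = \sum_(i < m) pr (A i).
  rewrite XE E_sum; last by move=> i; exact: integ_indic.
  by apply: eq_bigr => i _; rewrite E_indic.
have EY : E Y = \sum_(i < m) pr (B i).
  rewrite YE E_sum; last by move=> i; exact: integ_indic.
  by apply: eq_bigr => i _; rewrite E_indic.
have EXY : E (fun w => X w * Y w) = \sum_(i < m) \sum_(j < m) pr (A i `&` B j).
  have -> : (fun w => X w * Y w) =
      (fun w => \sum_(i < m) \sum_(j < m) \1_(A i `&` B j) w).
    apply/funext => w; rewrite XE YE mulr_suml; apply: eq_bigr => i _.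
    by rewrite mulr_sumr; apply: eq_bigr => j _; rewrite indicI.
  rewrite E_sum; last first.
    by move=> i; apply: integ_sum => j; apply/integ_indic/measurableI.
  apply: eq_bigr => i _; rewrite E_sum; last first.
    by move=> j; apply/integ_indic/measurableI.
  by apply: eq_bigr => j _; rewrite E_indic//; exact: measurableI.
rewrite EX EY EXY mulr_suml -sumrB.
apply: le_trans (ler_norm_sum _ _ _) _.
have -> : m%:R ^+ 2 * a = \sum_(i < m) \sum_(j < m) a.
  by rewrite !sumr_const !card_ord -mulrnA mulnn -natrX mulr_natl.
apply: ler_sum => i _; rewrite mulr_sumr -sumrB.
by apply: le_trans (ler_norm_sum _ _ _) _; exact: ler_sum.
Qed.

(** Hoeffding's formula writes the covariance as the integral over [0, K]^2 of the dependence
    between level sets. The integral is replaced by its Riemann sums: N X and N Y are rounded down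
    to integers, and N tends to infinity. *)
Lemma cov_nonneg (a K : R) (X Y : T -> R) : mf X -> mf Y -> 0 <= a ->
  (forall w, 0 <= X w <= K) -> (forall w, 0 <= Y w <= K) ->
  (forall s t, `|pr ([set w | s <= X w] `&` [set w | t <= Y w])
      - pr [set w | s <= X w] * pr [set w | t <= Y w]| <= a) ->
  `|E (fun w => X w * Y w) - E X * E Y| <= K ^+ 2 * a.
Proof.
move=> mX mY a0 X0 Y0 st.
have K0 : 0 <= K.
  by have /andP[] := X0 point; exact: le_trans.
have [iX iY] : integ X /\ integ Y.
  split; apply: (@integ_bounded _ _ _ _ _ K) => // w.
    by have /andP[? ?] := X0 w; rewrite ger0_norm.
  by have /andP[? ?] := Y0 w; rewrite ger0_norm.
apply/ler_addgt0Pr => e e0.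
(* On the scale N^2, rounding moves E(XY) and E(X)E(Y) by at most 2 N K each; after division by N^2
   the total error is 4 K / N. *)
pose N := (Num.truncn (4 * K / e)).+1.
have N0 : 0 < N%:R :> R by rewrite ltr0n.
have NK : 4 * K / N%:R <= e.
  rewrite ler_pdivrMr// -ler_pdivrMl// mulrC.
  exact/ltW/truncnS_gt.
pose A i := [set w | i.+1%:R / N%:R <= X w].
pose B i := [set w | i.+1%:R / N%:R <= Y w].
have mA i : measurable (A i) by exact: measurable_ge.
have mB i : measurable (B i) by exact: measurable_ge.
pose m := Num.truncn (N%:R * K).
pose XN w := \sum_(i < m) (\1_(A i) w : R).
pose YN w := \sum_(i < m) (\1_(B i) w : R).
have trE (Z : T -> R) w : 0 <= Z w <= K ->
    \sum_(i < m) (\1_[set w | i.+1%:R / N%:R <= Z w] w : R) = (Num.truncn (N%:R * Z w))%:R.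
  move=> /andP[Z0 ZK]; rewrite -(@sum_lev_nat m); last first.
    by apply: le_truncn; rewrite ler_pM2l.
  apply: eq_bigr => i _; rewrite indicE; congr (nat_of_bool _)%:R.
  rewrite truncn_ge_nat ?mulr_ge0 ?ler0n// -ler_pdivrMl// [_^-1 * _]mulrC.
  by apply/idP/idP; rewrite inE.
have approx (Z ZN : T -> R) : (forall w, 0 <= Z w <= K) ->
    (forall w, ZN w = (Num.truncn (N%:R * Z w))%:R) ->
    forall w, 0 <= N%:R * Z w - ZN w <= 1 /\ 0 <= ZN w <= N%:R * K.
  move=> Z0 ZN0 w; have /andP[z0 zK] := Z0 w.
  have z0' : 0 <= N%:R * Z w by rewrite mulr_ge0.
  have := truncn_itv z0' => /andP[h1 h2].
  rewrite ZN0 subr_ge0 h1 ler0n lerBlDl (le_trans h1) ?ler_pM2l//.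
  by rewrite -natr1 addrC in h2; rewrite addrC (ltW h2).
have aX := approx X XN X0 (fun w => trE X w (X0 w)).
have aY := approx Y YN Y0 (fun w => trE Y w (Y0 w)).
have iXN : integ XN by apply: integ_sum => i; exact: integ_indic.
have iYN : integ YN by apply: integ_sum => i; exact: integ_indic.
have iXY : integ (fun w => X w * Y w).
  apply: (@integ_bounded _ _ _ _ _ (K * K)); first exact: measurable_funM.
  move=> w; have /andP[? ?] := X0 w; have /andP[? ?] := Y0 w.
  by rewrite ger0_norm ?mulr_ge0// ler_pM.
have iXYN : integ (fun w => XN w * YN w).
  apply: (@integ_bounded _ _ _ _ _ ((N%:R * K) * (N%:R * K))).
    by apply: measurable_funM; [exact: (integ_mf iXN)|exact: (integ_mf iYN)].
  move=> w; have [_ /andP[? ?]] := aX w; have [_ /andP[? ?]] := aY w.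
  by rewrite ger0_norm ?mulr_ge0// ler_pM.
have cN : `|E (fun w => XN w * YN w) - E XN * E YN| <= m%:R ^+ 2 * a.
  by apply: (cov_discretized mA mB) => // i j; exact: st.
have mN : m%:R <= N%:R * K :> R by rewrite truncn_le mulr_ge0.
have d1 : `|N%:R ^+ 2 * E (fun w => X w * Y w) - E (fun w => XN w * YN w)|
    <= 2 * N%:R * K.
  rewrite -EZ// -EB//; last exact: integZ.
  rewrite -[leRHS](E_cst P); apply: E_abs_le.
  - by apply: integB => //; exact: integZ.
  - exact: integ_cst.
  move=> w /=; have [/andP[? ?] /andP[? ?]] := aX w.
  have [/andP[? ?] /andP[? ?]] := aY w.
  have /andP[? ?] := X0 w; have /andP[? ?] := Y0 w.
  have -> : N%:R ^+ 2 * (X w * Y w) - XN w * YN w =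
     (N%:R * X w) * (N%:R * Y w - YN w) + (N%:R * X w - XN w) * YN w by ring.
  have hX : N%:R * X w <= N%:R * K by rewrite ler_pM2l.
  rewrite ger0_norm; last by rewrite addr_ge0// mulr_ge0// mulr_ge0.
  have h1 : (N%:R * X w) * (N%:R * Y w - YN w) <= N%:R * K * 1.
    by rewrite ler_pM// mulr_ge0.
  have h2 : (N%:R * X w - XN w) * YN w <= 1 * (N%:R * K) by rewrite ler_pM.
  by lra.
have dE (Z ZN : T -> R) : integ Z -> integ ZN ->
   (forall w, 0 <= N%:R * Z w - ZN w <= 1 /\ 0 <= ZN w <= N%:R * K) ->
   0 <= N%:R * E Z - E ZN <= 1 /\ 0 <= E ZN <= N%:R * K.
  move=> iZ iZN aZ; rewrite -EZ// -EB//; last exact: integZ.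
  have iD : integ (fun w => N%:R * Z w - ZN w) by apply: integB => //; exact: integZ.
  split; apply/andP; split.
  - by apply: E_ge0 => w; have [/andP[]] := aZ w.
  - rewrite -[leRHS](E_cst P); apply: E_le => //; first exact: integ_cst.
    by move=> w; have [/andP[]] := aZ w.
  - by apply: E_ge0 => w; have [_ /andP[]] := aZ w.
  - rewrite -[leRHS](E_cst P); apply: E_le => //; first exact: integ_cst.
    by move=> w; have [_ /andP[]] := aZ w.
have [/andP[x1 x2] /andP[x3 x4]] := dE _ _ iX iXN aX.
have [/andP[y1 y2] /andP[y3 y4]] := dE _ _ iY iYN aY.
have EX0 : 0 <= E X by apply: E_ge0 => w; have /andP[] := X0 w.
have EXK : E X <= K.
  rewrite -[leRHS](E_cst P); apply: E_le => //; first exact: integ_cst.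
  by move=> w; have /andP[] := X0 w.
have d2 : `|N%:R ^+ 2 * (E X * E Y) - E XN * E YN| <= 2 * N%:R * K.
  have -> : N%:R ^+ 2 * (E X * E Y) - E XN * E YN =
     (N%:R * E X) * (N%:R * E Y - E YN) + (N%:R * E X - E XN) * E YN by ring.
  rewrite ger0_norm; last by rewrite addr_ge0// mulr_ge0// mulr_ge0.
  have hX : N%:R * E X <= N%:R * K by rewrite ler_pM2l.
  have h1 : (N%:R * E X) * (N%:R * E Y - E YN) <= N%:R * K * 1.
    by rewrite ler_pM// mulr_ge0.
  have h2 : (N%:R * E X - E XN) * E YN <= 1 * (N%:R * K) by rewrite ler_pM.
  by lra.
have ma : m%:R ^+ 2 * a <= (N%:R * K) ^+ 2 * a.
  by rewrite ler_wpM2r// lerXn2r ?nnegrE ?mulr_ge0.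
rewrite -(@ler_pM2l _ (N%:R ^+ 2)) ?exprn_gt0// -[X in X * `|_|]ger0_norm ?sqr_ge0//.
rewrite -normrM mulrBr.
apply: (@le_trans _ _ (2 * N%:R * K + (N%:R * K) ^+ 2 * a + 2 * N%:R * K)).
  move: d1 d2 cN ma.
  set u := _ * E _; set v := _ * (E _ * E _).
  set u' := E (fun w => XN w * _); set v' := E XN * E YN.
  move=> d1 d2 cN ma.
  have -> : u - v = (u - u') + (u' - v') - (v - v') by ring.
  apply: le_trans (ler_normB _ _) _; apply: lerD => //.
  apply: le_trans (ler_normD _ _) _; apply: lerD => //.
  exact: le_trans ma.
have -> : 2 * N%:R * K + (N%:R * K) ^+ 2 * a + 2 * N%:R * K =
   N%:R ^+ 2 * (K ^+ 2 * a + 4 * K / N%:R).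
  by field; rewrite gt_eqF.
by rewrite ler_pM2l ?exprn_gt0// lerD2l.
Qed.

(** Adding K keeps the covariance, only relabels the level sets, and puts both functions in [0, 2K];
    hence the factor 4. *)
Lemma cov_bounded (a K : R) (X Y : T -> R) : mf X -> mf Y -> 0 <= a ->
  (forall w, `|X w| <= K) -> (forall w, `|Y w| <= K) ->
  (forall s t, `|pr ([set w | s <= X w] `&` [set w | t <= Y w])
      - pr [set w | s <= X w] * pr [set w | t <= Y w]| <= a) ->
  `|E (fun w => X w * Y w) - E X * E Y| <= 4 * K ^+ 2 * a.
Proof.
move=> mX mY a0 XK YK st.
have iX := @integ_bounded _ _ _ P _ _ mX XK.
have iY := @integ_bounded _ _ _ P _ _ mY YK.
have iXY : integ (fun w => X w * Y w).
  apply: (@integ_bounded _ _ _ _ _ (K * K)); first exact: measurable_funM.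
  by move=> w; rewrite normrM ler_pM.
have lev (Z : T -> R) s : [set w | s <= Z w + K] = [set w | s - K <= Z w].
  by apply/seteqP; split => w /=; rewrite lerBlDr.
have := @cov_nonneg a (2 * K) (fun w => X w + K) (fun w => Y w + K).
have -> : (2 * K) ^+ 2 = 4 * K ^+ 2 by ring.
have -> : E (fun w => (X w + K) * (Y w + K)) - E (fun w => X w + K) * E (fun w => Y w + K)
   = E (fun w => X w * Y w) - E X * E Y.
  have -> : (fun w => (X w + K) * (Y w + K)) =
      (fun w => (X w * Y w + K * (X w + Y w)) + K ^+ 2) by apply/funext => w; ring.
  have iS : integ (fun w => X w + Y w) by exact: integD.
  have iK : integ (fun w => K * (X w + Y w)) by exact: integZ.
  have iXYK : integ (fun w => X w * Y w + K * (X w + Y w)) by exact: integD.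
  have ic c : integ (fun _ => c) by exact: integ_cst.
  by rewrite (ED iXYK (ic _)) (ED iXY iK) (EZ K iS) (ED iX iY) (ED iX (ic _))
    (ED iY (ic _)) !E_cst; ring.
apply => //.
- exact: measurable_funD.
- exact: measurable_funD.
- by move=> w; have := XK w; rewrite ler_norml => /andP[? ?]; apply/andP; split; lra.
- by move=> w; have := YK w; rewrite ler_norml => /andP[? ?]; apply/andP; split; lra.
- by move=> s t; rewrite !lev.
Qed.

End bounded_covariance.

(** * Strong mixing coefficients *)

Section mixing.
Context {d : measure_display} {T : measurableType d} {R : realType}.
Variable P : probability T R.
Variable e : nat -> {RV P >-> R}.

Local Notation E f := (Rintegral P setT f).
Local Notation integ f := (integrable P setT (EFin \o f)).
Local Notation pr A := (fine (P A)).
Local Notation mf f := (measurable_fun setT f).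
Local Notation gs := (gen_sigma (fun k => e k)).
Local Notation alpha := (alpha_mix P (fun k => e k)).

(* The generating family of gen_sigma, named so that measurability of real functions
   with respect to gen_sigma can be phrased over g_sigma_algebraType. *)
Definition gens (I : set nat) : set (set T) :=
  [set A | exists i, I i /\ exists B : set R, measurable B /\ A = e i @^-1` B].

Lemma gs_measurable (I : set nat) (A : set T) : gs I A -> measurable A.
Proof.
apply: smallest_sub; first exact: sigma_algebra_measurable.
by move=> B [i [_ [C [mC ->]]]]; rewrite -[_ @^-1` _]setTI; exact: measurable_funP.
Qed.

Lemma gs_mono (I J : set nat) (A : set T) : I `<=` J -> gs I A -> gs J A.
Proof.
move=> IJ; apply: sub_sigma_algebra2 => B [i [Ii h]].
by exists i; split => //; exact: IJ.
Qed.

Lemma gs_preimage (I : set nat) i (B : set R) : I i -> measurable B ->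
  gs I (e i @^-1` B).
Proof.
by move=> Ii mB; apply: sub_sigma_algebra; exists i; split => //; exists B.
Qed.

Definition dependence (A B : set T) : R := `|pr (A `&` B) - pr A * pr B|.

Lemma dependence_le1 A B : measurable A -> measurable B -> dependence A B <= 1.
Proof.
move=> mA mB; have mAB : measurable (A `&` B) by exact: measurableI.
have [a0 a1] := (pr_ge0 P A, pr_le1 P mA).
have [b0 b1] := (pr_ge0 P B, pr_le1 P mB).
have [c0 c1] := (pr_ge0 P (A `&` B), pr_le1 P mAB).
have h0 : 0 <= pr A * pr B by rewrite mulr_ge0.
have h1 : pr A * pr B <= 1 by rewrite mulr_ile1.
by rewrite ler_norml; apply/andP; split; lra.
Qed.

(** A real [sup] dominates its set only if the set is bounded above; here 1 is a bound. *)
Lemma dependence_le_alpha (j n : nat) (A B : set T) :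
  gs [set i | (i <= j)%N] A -> gs [set i | (j + n <= i)%N] B ->
  dependence A B <= alpha n.
Proof.
move=> gA gB; apply: ub_le_sup.
  exists 1 => r [k [C [D [gC [gD ->]]]]].
  by apply: dependence_le1; [exact: gs_measurable gC|exact: gs_measurable gD].
by exists j, A, B.
Qed.

Lemma alpha_ge0 n : 0 <= alpha n.
Proof.
apply: le_trans (normr_ge0 _) (@dependence_le_alpha 0 n set0 set0 _ _).
  exact: sigma_algebra0.
exact: sigma_algebra0.
Qed.

Lemma alpha_le_ub n (c : R) :
  (forall j A B, gs [set i | (i <= j)%N] A -> gs [set i | (j + n <= i)%N] B ->
   dependence A B <= c) -> alpha n <= c.
Proof.
move=> h; apply: ge_sup.
  exists (dependence set0 set0), 0%N, set0, set0.
  by split; [|split => //]; exact: sigma_algebra0.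
by move=> r [k [C [D [gC [gD ->]]]]]; exact: h gC gD.
Qed.

Lemma alpha_le1 n : alpha n <= 1.
Proof.
apply: alpha_le_ub => j A B gA gB.
by apply: dependence_le1; [exact: gs_measurable gA|exact: gs_measurable gB].
Qed.

Lemma alpha_anti m n : (m <= n)%N -> alpha n <= alpha m.
Proof.
move=> mn; apply: alpha_le_ub => j A B gA gB.
apply: (dependence_le_alpha gA); apply: gs_mono gB => i /=.
by apply: leq_trans; rewrite leq_add2l.
Qed.

(* Summability alone gives o(1/n); monotonicity of alpha upgrades it to n^-2. *)
Lemma alpha_quadratic :
  cvg (series (fun n => n%:R * alpha n) @ \oo) ->
  exists2 C : R, 0 <= C & forall n, n%:R ^+ 2 * alpha n <= C.
Proof.
set u := fun n => _.
have u0 n : 0 <= u n by rewrite mulr_ge0// alpha_ge0.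
move=> cu; exists (2 * limn (series u)).
  rewrite mulr_ge0//; apply: limr_ge => //; near=> n.
  by rewrite /series /= sumr_ge0.
move=> n; have h : series u n.+1 <= limn (series u).
  by apply: nondecreasing_cvgn_le => //; exact: nondecreasing_series.
rewrite -(ler_pM2l (_ : 0 < 2^-1)) ?invr_gt0//.
rewrite [leRHS]mulrA mulVf ?mul1r ?pnatr_eq0//; apply: le_trans h.
rewrite /series /= (@le_trans _ _ (\sum_(0 <= k < n.+1) (k%:R * alpha n)))//.
  rewrite -mulr_suml mulrA ler_wpM2r ?alpha_ge0// -natr_sum.
  have sq : (n ^ 2 <= 2 * \sum_(0 <= i < n.+1) i)%N.
    elim: n => [|n IH]; first by rewrite exp0n.
    by rewrite big_nat_recr//= mulnDr; move: IH; rewrite -!mulnn; lia.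
  rewrite -(ler_pM2l (_ : 0 < 2)) ?ltr0n// mulrA mulfV ?pnatr_eq0// mul1r.
  by rewrite -natrM -natrX ler_nat.
rewrite !big_nat; apply: ler_sum => k /andP[_ kn].
by rewrite ler_wpM2l// alpha_anti.
Unshelve. all: by end_near. Qed.

Hypothesis stat : strictly_stationary P (fun k => e k).

Lemma stationary1 i (B : set R) : measurable B ->
  P (e i @^-1` B) = P (e 0%N @^-1` B).
Proof.
move=> mB; have := stat 1 i (B := fun=> B) (fun=> mB).
have I1 (F : nat -> set T) : \bigcap_(k in `I_1) F k = F 0%N.
  by apply/seteqP; split => [w /(_ 0%N)|w Fw [|k]//]; exact.
by rewrite !I1 add0n.
Qed.

Lemma integral_stationary i (f : R -> R) : mf f -> (forall x, 0 <= f x) ->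
  (\int[P]_w (f (e i w))%:E = \int[P]_w (f (e 0%N w))%:E)%E.
Proof.
move=> mf f0.
have mF : measurable_fun setT (EFin \o f) by exact/measurable_EFinP.
have F0 y : (0 <= (EFin \o f) y)%E by rewrite lee_fin.
rewrite -(ge0_integral_distribution (e i) mF F0).
rewrite -(ge0_integral_distribution (e 0%N) mF F0).
by apply: eq_measure_integral => A mA _; exact: stationary1.
Qed.

Lemma integ_stationary i (f : R -> R) : mf f -> (forall x, 0 <= f x) ->
  integ (fun w => f (e 0%N w)) -> integ (fun w => f (e i w)).
Proof.
move=> mf f0 /integrableP[_ h]; apply/integrableP; split.
  by apply/measurable_EFinP; exact: measurableT_comp.
under eq_integral do rewrite /= ger0_norm//.
rewrite integral_stationary//.
apply: le_lt_trans h; rewrite le_eqVlt; apply/orP; left; apply/eqP.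
by apply: eq_integral => x _ /=; rewrite ger0_norm.
Qed.

Lemma E_stationary i (f : R -> R) : mf f -> (forall x, 0 <= f x) ->
  E (fun w => f (e i w)) = E (fun w => f (e 0%N w)).
Proof. by move=> mf f0; rewrite /Rintegral integral_stationary. Qed.

End mixing.

(** * Davydov's inequality and variance of sums *)

Lemma le_geometric_mean {R : realType} (x y t : R) : 0 <= x -> 0 <= y ->
  0 <= t <= 1 -> Num.min x y <= x `^ t * y `^ (1 - t).
Proof.
move=> x0 y0 /andP[t0 t1].
have sp z : 0 < z -> z = z `^ t * z `^ (1 - t) :> R.
  move=> z0; rewrite -powRD; last by rewrite (gt_eqF z0) implybT.
  by rewrite addrC subrK powRr1// ltW.
have [xy|/ltW yx] := leP x y.
  have [->|xn0] := eqVneq x 0; first by rewrite mulr_ge0// powR_ge0.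
  rewrite {1}(sp x) ?lt_neqAle ?x0 1?eq_sym ?xn0// ler_wpM2l ?powR_ge0//.
  by rewrite ge0_ler_powR ?nnegrE// subr_ge0.
have [->|yn0] := eqVneq y 0; first by rewrite mulr_ge0// powR_ge0.
rewrite {1}(sp y) ?lt_neqAle ?y0 1?eq_sym ?yn0// ler_wpM2r ?powR_ge0//.
by rewrite ge0_ler_powR ?nnegrE.
Qed.

Section davydov.
Context {d : measure_display} {T : measurableType d} {R : realType}.
Variable P : probability T R.
Variable e : nat -> {RV P >-> R}.

Local Notation E f := (Rintegral P setT f).
Local Notation integ f := (integrable P setT (EFin \o f)).
Local Notation pr A := (fine (P A)).
Local Notation mf f := (measurable_fun setT f).
Local Notation alpha := (alpha_mix P (fun k => e k)).

Variables (p A : R).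
Hypothesis p2 : 2 < p.
Hypothesis ip : forall i, integ (fun w => `|e i w| `^ p).
Hypothesis Ep : forall i, E (fun w => `|e i w| `^ p) <= A.

Definition tail_sqr (B x : R) : R := if `|x| <= B then 0 else x ^+ 2.

Lemma tail_sqr_ge0 B x : 0 <= tail_sqr B x.
Proof. by rewrite /tail_sqr; case: ifP => // _; exact: sqr_ge0. Qed.

Lemma measurable_le_norm (B : R) : measurable_fun [set: R] (fun x : R => `|x| <= B).
Proof.
exact: measurable_fun_ler.
Qed.

Lemma measurable_tail_sqr B : measurable_fun setT (tail_sqr B).
Proof.
by apply: measurable_fun_ifT => //; exact: measurable_le_norm.
Qed.

(** The exponent 2 - p is negative, so |x|^(2-p) is at most B^(2-p) once |x| exceeds B. *)
Lemma tail_sqr_le B x : 0 < B -> tail_sqr B x <= B `^ (2 - p) * `|x| `^ p.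
Proof.
move=> B0; rewrite /tail_sqr; case: ifPn => [_|]; first by rewrite mulr_ge0// powR_ge0.
rewrite -ltNge => Bx; have x0 : 0 < `|x| by exact: lt_trans Bx.
rewrite -(real_normK (num_real x)).
have -> : `|x| ^+ 2 = `|x| `^ (2 - p) * `|x| `^ p.
  rewrite -powRD; last by rewrite (gt_eqF x0) implybT.
  by rewrite subrK powR_mulrn.
rewrite ler_wpM2r ?powR_ge0//.
rewrite -(opprB p 2) !powRN lef_pV2 ?posrE ?powR_gt0//.
by rewrite ge0_ler_powR ?nnegrE// ?ltW// subr_gt0.
Qed.

Lemma integ_tail_sqr B i : 0 < B -> integ (fun w => tail_sqr B (e i w)).
Proof.
move=> B0; apply: (integ_dom _ (integZ (B `^ (2 - p)) (ip i))).
  by apply: measurableT_comp => //; exact: measurable_tail_sqr.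
by move=> w; rewrite ger0_norm ?tail_sqr_ge0// tail_sqr_le.
Qed.

Lemma E_tail_sqr B i : 0 < B -> E (fun w => tail_sqr B (e i w)) <= B `^ (2 - p) * A.
Proof.
move=> B0; apply: (@le_trans _ _ (B `^ (2 - p) * E (fun w => `|e i w| `^ p))).
  rewrite -EZ//; apply: E_le; [exact: integ_tail_sqr|exact: integZ|].
  by move=> w; exact: tail_sqr_le.
by rewrite ler_wpM2l ?powR_ge0.
Qed.

Lemma integ_sqr i : integ (fun w => e i w ^+ 2).
Proof.
apply: (integ_dom _ (integD (integ_cst P 1) (integ_tail_sqr i ltr01))).
  exact: measurable_funX.
move=> w; rewrite ger0_norm ?sqr_ge0// /tail_sqr; case: ifPn => [h|_].
  by rewrite addr0 -(real_normK (num_real (e i w))) exprn_ile1.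
by rewrite lerDr.
Qed.

Lemma E_sqr_le i : E (fun w => e i w ^+ 2) <= 1 + A.
Proof.
apply: (@le_trans _ _ (E (fun w => 1 + tail_sqr 1 (e i w)))).
  apply: E_le; [exact: integ_sqr|apply: integD; [exact: integ_cst|exact: integ_tail_sqr]|].
  move=> w; rewrite /tail_sqr; case: ifPn => [h|_].
    by rewrite addr0 -(real_normK (num_real (e i w))) exprn_ile1.
  by rewrite lerDr.
rewrite ED ?E_cst//; [|exact: integ_cst|exact: integ_tail_sqr].
by rewrite lerD2l; apply: le_trans (E_tail_sqr _ ltr01) _; rewrite powR1 mul1r.
Qed.

Lemma integ_mul_dom (f g : T -> R) (i j : nat) : mf f -> mf g ->
  (forall w, `|f w| <= `|e i w|) -> (forall w, `|g w| <= `|e j w|) ->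
  integ (fun w => f w * g w).
Proof.
move=> mf mg fe ge; apply: (integ_dom _ (integD (integ_sqr i) (integ_sqr j))).
  exact: measurable_funM.
move=> w; rewrite normrM.
have h : `|f w| * `|g w| <= `|e i w| * `|e j w| by rewrite ler_pM.
apply: (le_trans h); rewrite -(real_normK (num_real (e i w))).
rewrite -(real_normK (num_real (e j w))).
by have := sqr_ge0 (`|e i w| - `|e j w|); nra.
Qed.

Lemma integ_dom1 (f : T -> R) (i : nat) : mf f ->
  (forall w, `|f w| <= `|e i w|) -> integ f.
Proof.
move=> mf fe; apply: (integ_dom _ (integD (integ_cst P 1) (integ_sqr i))) => //.
move=> w; apply: (le_trans (fe w)); rewrite -(real_normK (num_real (e i w))).
by have := sqr_ge0 (`|e i w| - 1); nra.
Qed.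

(** The cut is made on x and not on f x, so that the error is controlled by [tail_sqr B x] for every
    f dominated by the identity. *)
Definition truncate (B : R) (f : R -> R) (x : R) : R := if `|x| <= B then f x else 0.

Lemma truncate_bound B f x : 0 <= B -> (forall x, `|f x| <= `|x|) -> `|truncate B f x| <= B.
Proof.
move=> B0 fx; rewrite /truncate; case: ifPn => [h|_]; last by rewrite normr0.
exact: le_trans (fx x) h.
Qed.

Lemma truncate_le B f x : (forall x, `|f x| <= `|x|) -> `|truncate B f x| <= `|x|.
Proof.
by move=> fx; rewrite /truncate; case: ifPn => // _; rewrite normr0.
Qed.

Lemma measurable_truncate B f : mf f -> mf (truncate B f).
Proof.
move=> mf; apply: measurable_fun_ifT => //; exact: measurable_le_norm.
Qed.

Lemma truncate_diff B f x : 0 <= B -> (forall x, `|f x| <= `|x|) ->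
  B * `|f x - truncate B f x| <= tail_sqr B x.
Proof.
move=> B0 fx; rewrite /truncate /tail_sqr; case: ifPn => [h|].
  by rewrite subrr normr0 mulr0.
rewrite -ltNge subr0 => Bx; rewrite -(real_normK (num_real x)) expr2.
by rewrite ler_pM// ltW.
Qed.

(** If exactly one of |x|, |y| exceeds B, the product is at most the square of that one; if both do,
    the arithmetic-geometric inequality applies. *)
Lemma truncate_mul_diff B f g x y : 0 <= B ->
  (forall x, `|f x| <= `|x|) -> (forall x, `|g x| <= `|x|) ->
  `|f x * g y - truncate B f x * truncate B g y| <= tail_sqr B x + tail_sqr B y.
Proof.
move=> B0 fx gy.
have h : `|f x * g y| <= `|x| * `|y| by rewrite normrM ler_pM.
have [x0 y0] := (normr_ge0 x, normr_ge0 y).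
rewrite /truncate /tail_sqr; case: ifPn => [xB|]; case: ifPn => [yB|].
- by rewrite subrr normr0 addr0.
- rewrite -ltNge mulr0 subr0 add0r => By; apply: (le_trans h).
  rewrite -(real_normK (num_real y)) expr2 ler_wpM2r//.
  exact/ltW/(le_lt_trans xB).
- rewrite -ltNge mul0r subr0 addr0 => Bx; apply: (le_trans h).
  rewrite -(real_normK (num_real x)) expr2 ler_wpM2l//.
  exact/ltW/(le_lt_trans yB).
- move=> _ _; rewrite mul0r subr0; apply: (le_trans h).
  rewrite -(real_normK (num_real x)) -(real_normK (num_real y)).
  by have := sqr_ge0 (`|x| - `|y|); nra.
Qed.

Definition cov (X Y : T -> R) : R := E (fun w => X w * Y w) - E X * E Y.

Lemma cov_truncation (f g : R -> R) (i k : nat) (B : R) : 1 <= B ->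
  mf f -> mf g -> (forall x, `|f x| <= `|x|) -> (forall x, `|g x| <= `|x|) ->
  `|cov (f \o e i) (g \o e (i + k)%N)|
     <= 4 * B ^+ 2 * alpha k + (4 + A) * (B `^ (2 - p) * A).
Proof.
move=> B1 mf mg fx gx; set j := (i + k)%N.
have B0 : 0 < B by exact: lt_le_trans B1.
pose f1 := truncate B f; pose g1 := truncate B g.
pose t := B `^ (2 - p) * A.
have me (l : nat) (h : R -> R) : measurable_fun setT h -> measurable_fun setT (h \o e l).
  by move=> mh; exact: measurableT_comp.
have mf1 := measurable_truncate B mf; have mg1 := measurable_truncate B mg.
have A0 : 0 <= A.
  by apply: le_trans (Ep 0); apply: E_ge0 => w; exact: powR_ge0.
have t0 : 0 <= t by rewrite mulr_ge0// powR_ge0.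
have tA : t <= A.
  rewrite -[leRHS]mul1r ler_wpM2r// -(opprB p 2) powRN invf_le1 ?powR_gt0//.
  apply: (@le_trans _ _ (B `^ 0)); first by rewrite powRr0.
  by rewrite ler_powR// subr_ge0 ltW.
have c1 : `|cov (f1 \o e i) (g1 \o e j)| <= 4 * B ^+ 2 * alpha k.
  apply: cov_bounded.
  - exact: me.
  - exact: me.
  - exact: alpha_ge0.
  - by move=> w; apply: truncate_bound => //; exact: ltW.
  - by move=> w; apply: truncate_bound => //; exact: ltW.
  move=> s u; apply: (@dependence_le_alpha _ _ _ P e i).
    by apply: (@gs_preimage _ _ _ P e _ i [set x | s <= f1 x]) => //=; exact: measurable_ge.
  by apply: (@gs_preimage _ _ _ P e _ j [set x | u <= g1 x]) => //=; exact: measurable_ge.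
have ifg : integ (fun w => f (e i w) * g (e j w)).
  by apply: (@integ_mul_dom _ _ i j) => //; exact: me.
have if1g1 : integ (fun w => f1 (e i w) * g1 (e j w)).
  apply: (@integ_mul_dom _ _ i j); [exact: me|exact: me| |].
    by move=> w; exact: truncate_le.
  by move=> w; exact: truncate_le.
have c2 : `|E (fun w => f (e i w) * g (e j w)) - E (fun w => f1 (e i w) * g1 (e j w))|
    <= 2 * t.
  rewrite -EB//.
  apply: (@le_trans _ _ (E (fun w => tail_sqr B (e i w) + tail_sqr B (e j w)))).
    apply: E_abs_le; [exact: integB|by apply: integD; exact: integ_tail_sqr|].
    by move=> w; apply: truncate_mul_diff => //; exact: ltW.
  rewrite ED; [|exact: integ_tail_sqr|exact: integ_tail_sqr].
  by rewrite mulr_natl mulr2n lerD// E_tail_sqr.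
have one (h : R -> R) (l : nat) : measurable_fun setT h -> (forall x, `|h x| <= `|x|) ->
    [/\ integ (h \o e l), integ (truncate B h \o e l),
      B * `|E (h \o e l) - E (truncate B h \o e l)| <= t & `|E (truncate B h \o e l)| <= B].
  move=> mh hx; have ih : integ (h \o e l).
    apply: (@integ_dom1 _ l); first exact: me.
    by move=> w; exact: hx.
  have ih1 : integ (truncate B h \o e l).
    apply: (@integ_dom1 _ l); first by apply: me; exact: measurable_truncate.
    by move=> w; exact: truncate_le.
  split=> //.
    rewrite -{1}(gtr0_norm B0) -normrM -EB//.
    rewrite -EZ; last exact: integB.
    apply: le_trans (E_tail_sqr l B0); apply: E_abs_le.
    - by apply/integZ/integB.
    - exact: integ_tail_sqr.
    - by move=> w; rewrite normrM (gtr0_norm B0); apply: truncate_diff => //; exact: ltW.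
  rewrite -[leRHS](E_cst P); apply: E_abs_le => //; first exact: integ_cst.
  by move=> w; apply: truncate_bound => //; exact: ltW.
have [if_ if1 fd fB] := one f i mf fx.
have [ig ig1 gd gB] := one g j mg gx.
(* In the two cross terms, a truncated mean of size at most B meets an error that is at most t even
   after multiplication by B. The product of the two errors is at most A t, because t is at most
   A. *)
have c3 : `|E (f \o e i) * E (g \o e j) - E (f1 \o e i) * E (g1 \o e j)| <= (2 + A) * t.
  have -> : E (f \o e i) * E (g \o e j) - E (f1 \o e i) * E (g1 \o e j) =
    (E (f \o e i) - E (f1 \o e i)) * (E (g \o e j) - E (g1 \o e j)) +
    (E (f \o e i) - E (f1 \o e i)) * E (g1 \o e j) +
    E (f1 \o e i) * (E (g \o e j) - E (g1 \o e j)) by ring.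
  move: fd fB gd gB.
  set a := _ - E (truncate _ _ \o _); set b := _ - E (truncate _ g \o _).
  rewrite -/f1 -/g1.
  set a1 := E (f1 \o _); set b1 := E (g1 \o _).
  move=> fd fB gd gB.
  have ha : `|a| <= t.
    by apply: le_trans fd; rewrite ler_peMl.
  have hb : `|b| <= t.
    by apply: le_trans gd; rewrite ler_peMl.
  have h1 : `|a * b| <= A * t by rewrite normrM ler_pM// (le_trans ha).
  have h2 : `|a * b1| <= t.
    by rewrite normrM mulrC (le_trans _ fd)// ler_wpM2r.
  have h3 : `|a1 * b| <= t.
    by rewrite normrM (le_trans _ gd)// ler_wpM2r.
  apply: le_trans (ler_normD _ _) _.
  have h4 := ler_normD (a * b) (a * b1).
  by lra.
have tri (u u1 v v1 a : R) : `|u1 - v1| <= a -> `|u - u1| <= 2 * t ->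
    `|v - v1| <= (2 + A) * t -> `|u - v| <= a + (4 + A) * t.
  move=> h1 h2 h3.
  have -> : u - v = (u1 - v1) + (u - u1) - (v - v1) by ring.
  apply: le_trans (ler_normB _ _) _.
  have := ler_normD (u1 - v1) (u - u1).
  by lra.
exact: tri c1 c2 c3.
Qed.

Let C1 : R := 4 + (4 + A) * A.

Let A0 : 0 <= A.
Proof. by apply: le_trans (Ep 0); apply: E_ge0 => w; exact: powR_ge0. Qed.

Let p0 : 0 < p.
Proof. by apply: lt_trans p2. Qed.

(* Davydov's exponent, from truncating at B = alpha(k)^(-1/p); when alpha(k) = 0 the
   level B is sent to infinity instead. *)
Lemma cov_alpha (f g : R -> R) (i k : nat) :
  mf f -> mf g -> (forall x, `|f x| <= `|x|) -> (forall x, `|g x| <= `|x|) ->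
  `|cov (f \o e i) (g \o e (i + k)%N)| <= C1 * alpha k `^ (1 - 2 / p).
Proof.
move=> mf mg fx gx.
have q0 : 0 < 1 - 2 / p by rewrite subr_gt0 ltr_pdivrMr// mul1r.
have h B (B1 : 1 <= B) := @cov_truncation f g i k B B1 mf mg fx gx.
have [a0|an0] := eqVneq (alpha k) 0; last first.
  have apos : 0 < alpha k by rewrite lt_neqAle eq_sym an0 alpha_ge0.
  pose B := alpha k `^ (- p^-1).
  have B1 : 1 <= B.
    rewrite /B powRN -(invr1 R) lef_pV2 ?posrE ?ltr01 ?powR_gt0//.
    have pV0 : 0 <= p^-1 by rewrite invr_ge0 ltW.
    have := ge0_ler_powR pV0 (_ : alpha k \in Num.nneg) (_ : 1 \in Num.nneg) (alpha_le1 e k).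
    by rewrite powR1 !nnegrE; apply => //; exact: alpha_ge0.
  apply: le_trans (h B B1) _; rewrite /C1 [leRHS]mulrDl lerD//.
    rewrite -mulrA ler_wpM2l// -powR_mulrn ?powR_ge0// -powRrM.
    rewrite -{2}(powRr1 (alpha_ge0 e k)) -powRD; last by rewrite an0 implybT.
    by have -> : - p^-1 * 2 + 1 = 1 - 2 / p by (field; rewrite gt_eqF).
  rewrite -mulrA ler_wpM2l ?addr_ge0// mulrC ler_wpM2l// -powRrM.
  by have -> : - p^-1 * (2 - p) = 1 - 2 / p by (field; rewrite gt_eqF).
rewrite a0 powR0 ?gt_eqF// mulr0; apply/ler_addgt0Pr => eps eps0; rewrite add0r.
pose c := (4 + A) * A.
have c0 : 0 <= c by rewrite mulr_ge0// addr_ge0.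
have ce : 1 <= c / eps + 1 by rewrite lerDr divr_ge0// ltW.
have ce0 : 0 < c / eps + 1 by exact: lt_le_trans ce.
(* This makes c B^(2-p) equal to c / (c / eps + 1), which is at most eps; the summand 1 ensures B >=
   1. *)
pose B := (c / eps + 1) `^ ((p - 2)^-1).
have pm2 : 0 < p - 2 by rewrite subr_gt0.
have B1 : 1 <= B.
  apply: (@le_trans _ _ (1 `^ (p - 2)^-1)); first by rewrite powR1.
  by rewrite ge0_ler_powR ?nnegrE ?invr_ge0// ltW.
apply: le_trans (h B B1) _.
rewrite a0 mulr0 add0r -(opprB p 2) powRN -powRrM mulVf ?gt_eqF// (powRr1 (ltW ce0)).
rewrite mulrCA mulrC -/c ler_pdivrMr// mulrDr mulr1 mulrCA mulfV ?gt_eqF// mulr1.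
by rewrite lerDl ltW.
Qed.

Lemma cov_second_moment (X Y : T -> R) (V : R) : integ X -> integ Y ->
  integ (fun w => X w * Y w) ->
  integ (fun w => X w ^+ 2) -> integ (fun w => Y w ^+ 2) ->
  E (fun w => X w ^+ 2) <= V -> E (fun w => Y w ^+ 2) <= V ->
  `|cov X Y| <= 2 * V.
Proof.
move=> iX iY iXY iX2 iY2 XV YV.
have jensen (Z : T -> R) : integ Z -> integ (fun w => Z w ^+ 2) ->
    E Z ^+ 2 <= E (fun w => Z w ^+ 2).
  move=> iZ iZ2; rewrite -subr_ge0.
  have : 0 <= E (fun w => (Z w - E Z) ^+ 2) by apply: E_ge0 => w; exact: sqr_ge0.
  have -> : (fun w => (Z w - E Z) ^+ 2) =
     (fun w => (Z w ^+ 2 - (2 * E Z) * Z w) + E Z ^+ 2) by apply/funext => w; ring.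
  have iZE : integ (fun w => (2 * E Z) * Z w) by exact: integZ.
  have iD : integ (fun w => Z w ^+ 2 - (2 * E Z) * Z w) by exact: integB.
  rewrite (ED iD (integ_cst P _)) (EB iZ2 iZE) (EZ _ iZ) E_cst.
  have -> // : E (fun w => Z w ^+ 2) - 2 * E Z * E Z + E Z ^+ 2 =
    E (fun w => Z w ^+ 2) - E Z ^+ 2 by ring.
have hX := jensen _ iX iX2; have hY := jensen _ iY iY2.
have h1 : `|E (fun w => X w * Y w)| <= V.
  apply: (@le_trans _ _ (E (fun w => 2^-1 * (X w ^+ 2 + Y w ^+ 2)))).
    apply: E_abs_le => //; first by apply/integZ/integD.
    move=> w; rewrite -(real_normK (num_real (X w))) -(real_normK (num_real (Y w))) normrM.
    by have := sqr_ge0 (`|X w| - `|Y w|); nra.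
  rewrite EZ ?ED//; last exact: integD.
  by lra.
have h2 : `|E X * E Y| <= V.
  rewrite normrM.
  move: hX hY; rewrite -(real_normK (num_real (E X))) -(real_normK (num_real (E Y))).
  by have := sqr_ge0 (`|E X| - `|E Y|); nra.
apply: le_trans (ler_normB _ _) _; lra.
Qed.

(* The free parameter x (a bound on the second moment) is what makes the contribution
   of the tails of e small; t > 0 is available because of the assumption r > 2. *)
Lemma cov_interpolation (f : R -> R) (M x t : R) (i k : nat) :
  mf f -> (forall x, `|f x| <= `|x|) -> 0 <= M -> 0 <= x -> 0 <= t <= 1 ->
  (forall j, E (fun w => f (e j w) ^+ 2) <= M * x) ->
  `|cov (f \o e i) (f \o e (i + k)%N)| <=
    (C1 + 2 * M) * (x `^ t * alpha k `^ ((1 - 2 / p) * (1 - t))).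
Proof.
move=> mf fx M0 x0 t01 fM.
have C10 : 0 <= C1 by rewrite addr_ge0// mulr_ge0// addr_ge0.
have me l : measurable_fun setT (f \o e l) by exact: measurableT_comp.
have i1 l : integ (f \o e l).
  by apply: (@integ_dom1 _ l); [exact: me|move=> w; exact: fx].
have i2 l m : integ (fun w => f (e l w) * f (e m w)).
  by apply: (@integ_mul_dom _ _ l m); [exact: me|exact: me|move=> w; exact: fx|move=> w; exact: fx].
have h1 := cov_alpha i k mf mf fx fx.
have h2 : `|cov (f \o e i) (f \o e (i + k)%N)| <= 2 * M * x.
  have i3 l : integ (fun w => (f \o e l) w ^+ 2) by exact: i2.
  rewrite -mulrA; apply: cov_second_moment => //.
  - exact: i2.
  - exact: fM.
  - exact: fM.
rewrite powRrM.
apply: (@le_trans _ _ ((C1 + 2 * M) * Num.min x (alpha k `^ (1 - 2 / p)))); last first.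
  have CM : 0 <= C1 + 2 * M by apply: addr_ge0 => //; exact: mulr_ge0.
  rewrite ler_wpM2l//.
  by apply: le_geometric_mean => //; exact: powR_ge0.
have [_|_] := leP x _.
  by apply: (le_trans h2); rewrite ler_wpM2r// lerDr.
by apply: (le_trans h1); rewrite ler_wpM2r ?powR_ge0// lerDl mulr_ge0.
Qed.

Lemma E_centered_mul (X Y : T -> R) : integ X -> integ Y ->
  integ (fun w => X w * Y w) ->
  integ (fun w => (X w - E X) * (Y w - E Y)) /\
  E (fun w => (X w - E X) * (Y w - E Y)) = cov X Y.
Proof.
move=> iX iY iXY.
have -> : (fun w => (X w - E X) * (Y w - E Y)) =
    (fun w => X w * Y w - (E Y * X w + E X * Y w) + E X * E Y).
  by apply/funext => w; ring.
have iL : integ (fun w => E Y * X w + E X * Y w) by apply: integD; exact: integZ.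
have iB : integ (fun w => X w * Y w - (E Y * X w + E X * Y w)) by exact: integB.
have ic : integ (fun _ => E X * E Y) by exact: integ_cst.
split; first exact: integD.
rewrite ED// EB// ED; [|exact: integZ|exact: integZ].
by rewrite (EZ _ iX) (EZ _ iY) E_cst /cov; ring.
Qed.

End davydov.

(** Subtraction is truncated, so one of the two summands is 0. *)
Definition natdist (i j : nat) : nat := ((i - j) + (j - i))%N.

(** Every distance from i occurs at most once on each side of i. The range is first enlarged to one
    that contains i, and the left half is then read backwards. *)
Lemma sum_natdist_le {R : realType} (a : nat -> R) (S : R) (m n i : nat) :
  (forall k, 0 <= a k) -> (forall n, \sum_(0 <= k < n) a k <= S) ->
  \sum_(m <= j < n) a (natdist i j) <= 2 * S.
Proof.
move=> a0 aS.
have le0 b1 b2 (F : nat -> R) : (forall k, 0 <= F k) ->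
    \sum_(b1 <= j < b2) F j <= \sum_(0 <= j < i + b2) F j.
  move=> F0; have sF (u v : nat) : 0 <= \sum_(u <= k < v) F k by exact: sumr_ge0.
  have [b12|b21] := leqP b1 b2; last by rewrite (big_geq (ltnW b21)).
  rewrite (@big_cat_nat _ _ _ b1 0 (i + b2)) ?(leq_trans b12) ?leq_addl//=.
  rewrite (@big_cat_nat _ _ _ b2 b1 (i + b2)) ?leq_addl//=.
  by rewrite addrCA lerDl addr_ge0.
apply: (le_trans (le0 _ _ (fun j => a (natdist i j)) (fun k => a0 _))).
rewrite (@big_cat_nat _ _ _ i 0 (i + n)) ?leq_addr//= mulr_natl mulr2n lerD//.
  rewrite big_nat_rev /= add0n.
  apply: le_trans (aS i.+1); rewrite big_nat_recl//.
  rewrite (_ : \sum_(0 <= k < i) a k.+1 = \sum_(0 <= k < i) a (natdist i (i - k.+1))).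
    by rewrite lerDr.
  rewrite !big_nat; apply: eq_bigr => k /andP[_ ki]; congr a.
  by rewrite /natdist; lia.
rewrite -{1}[i]add0n big_addn addKn.
rewrite (eq_bigr a); first exact: aS.
by move=> k _; congr a; rewrite /natdist; lia.
Qed.

Section variance_of_sums.
Context {d : measure_display} {T : measurableType d} {R : realType}.
Variable P : probability T R.

Local Notation E f := (Rintegral P setT f).
Local Notation integ f := (integrable P setT (EFin \o f)).

Lemma variance_sum_le (X : nat -> T -> R) (s a : nat -> R) (K c S : R) (m n : nat) :
  (m <= n)%N ->
  (forall i j, integ (fun w => X i w * X j w)) ->
  (forall i k, `|E (fun w => X i w * X (i + k)%N w)| <= c * a k) ->
  0 <= c -> (forall k, 0 <= a k) -> (forall n, \sum_(0 <= k < n) a k <= S) ->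
  (forall i, `|s i| <= K) ->
  integ (fun w => (\sum_(m <= i < n) s i * X i w) ^+ 2) /\
  E (fun w => (\sum_(m <= i < n) s i * X i w) ^+ 2)
    <= K ^+ 2 * (c * (2 * S)) * (n - m)%:R.
Proof.
move=> mn iX XX c0 a0 aS sK.
have -> : (fun w => (\sum_(m <= i < n) s i * X i w) ^+ 2) =
    (fun w => \sum_(m <= i < n) \sum_(m <= j < n) (s i * s j) * (X i w * X j w)).
  apply/funext => w; rewrite expr2 mulr_suml; apply: eq_bigr => i _.
  by rewrite mulr_sumr; apply: eq_bigr => j _; rewrite mulrACA.
have ii i j : integ (fun w => (s i * s j) * (X i w * X j w)) by exact: integZ.
have is_ i : integ (fun w => \sum_(m <= j < n) (s i * s j) * (X i w * X j w)).
  exact: integ_sum.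
split; first exact: integ_sum.
rewrite E_sum//.
have XXd i j : `|E (fun w => X i w * X j w)| <= c * a (natdist i j).
  have [ij|/ltnW ji] := leqP i j.
    have -> : natdist i j = (j - i)%N by rewrite /natdist; lia.
    by have := XX i (j - i)%N; rewrite subnKC.
  have -> : natdist i j = (i - j)%N by rewrite /natdist; lia.
  have := XX j (i - j)%N; rewrite subnKC//.
  by under eq_fun do rewrite mulrC.
have K0 : 0 <= K by apply: le_trans (sK 0%N).
apply: (@le_trans _ _ (\sum_(m <= i < n) K ^+ 2 * (c * (2 * S)))).
  apply: ler_sum => i _; rewrite E_sum//.
  apply: (@le_trans _ _ (\sum_(m <= j < n) K ^+ 2 * c * a (natdist i j))).
    apply: ler_sum => j _; rewrite EZ//.
    apply: (le_trans (ler_norm _)); rewrite normrM normrM.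
    by rewrite -[leRHS]mulrA expr2 ler_pM ?mulr_ge0// ler_pM.
  rewrite -mulr_sumr mulrA ler_wpM2l ?mulr_ge0 ?sqr_ge0//.
  exact: sum_natdist_le.
by rewrite sumr_const_nat mulr_natr.
Qed.

End variance_of_sums.

(** * Maximal inequalities *)

Section rademacher_menshov.
Context {R : realType}.
Implicit Types x : nat -> R.

(* Sum of the squares of all dyadic block sums of x inside [a, a + 2^j[. *)
Fixpoint dyadic_energy x (j a : nat) : R :=
  (\sum_(a <= k < a + 2 ^ j) x k) ^+ 2 +
  if j is j'.+1 then dyadic_energy x j' a + dyadic_energy x j' (a + 2 ^ j') else 0.

Lemma dyadic_energy_ge0 x j a : 0 <= dyadic_energy x j a.
Proof.
elim: j a => [|j IH] a /=; first by rewrite addr0 sqr_ge0.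
by rewrite addr_ge0 ?sqr_ge0// addr_ge0.
Qed.

Lemma le_dyadic_energy x j a : (\sum_(a <= k < a + 2 ^ j) x k) ^+ 2 <= dyadic_energy x j a.
Proof.
case: j => [|j] /=; first by rewrite addr0.
by rewrite lerDl addr_ge0// dyadic_energy_ge0.
Qed.

(** An initial segment of a dyadic block is a disjoint union of dyadic blocks, at most one per
    level; [j.+1] is the Cauchy-Schwarz factor for that many terms. *)
Lemma dyadic_maximal x j a i : (i <= 2 ^ j)%N ->
  (\sum_(a <= k < a + i) x k) ^+ 2 <= j.+1%:R * dyadic_energy x j a.
Proof.
elim: j a i => [|j IH] a i.
  rewrite expn0 mul1r; case: i => [_|[|//] _]; last exact: (@le_dyadic_energy x 0 a).
  by rewrite addn0 big_geq// expr0n; exact: dyadic_energy_ge0.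
move=> ij /=; have [i1|i1] := leqP i (2 ^ j)%N.
  apply: (le_trans (IH a i i1)).
  have q0 := dyadic_energy_ge0 x j a.
  have q1 := dyadic_energy_ge0 x j (a + 2 ^ j).
  rewrite ler_pM// ?ler_nat// addrCA lerDl.
  by rewrite addr_ge0// sqr_ge0.
have i2 : (i - 2 ^ j <= 2 ^ j)%N by rewrite leq_subLR addnn -mul2n -expnS.
have := IH (a + 2 ^ j)%N _ i2.
have -> : (a + 2 ^ j + (i - 2 ^ j))%N = (a + i)%N by rewrite -addnA subnKC// ltnW.
have := le_dyadic_energy x j a.
rewrite (@big_cat_nat _ _ _ (a + 2 ^ j) a (a + i)) ?leq_addr ?leq_add2l ?(ltnW i1)//=.
set u := \sum_(a <= k < a + 2 ^ j) _; set v := \sum_(a + 2 ^ j <= k < _) _.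
set w := (\sum_(a <= k < a + 2 ^ j.+1) _) ^+ 2.
set q1 := dyadic_energy _ _ a; set q2 := dyadic_energy _ _ (a + _).
move=> uq vq; have w0 : 0 <= w by exact: sqr_ge0.
have t0 : 0 < j.+1%:R :> R by rewrite ltr0n.
rewrite -[j.+2%:R]natr1; move: t0 vq; set t : R := j.+1%:R => t0 vq.
rewrite -(ler_pM2l t0).
(* Cauchy-Schwarz with weights 1 and t, since v already carries t terms: (u + v)^2 <= (t + 1)(u^2 +
   v^2 / t). *)
have id : t * (u + v) ^+ 2 = (t + 1) * (t * u ^+ 2 + v ^+ 2) - (t * u - v) ^+ 2 by ring.
apply: (@le_trans _ _ ((t + 1) * (t * u ^+ 2 + v ^+ 2))).
  by rewrite id gerBl sqr_ge0.
have t1 : 0 <= t + 1 by rewrite addr_ge0// ltW.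
rewrite [leRHS]mulrCA ler_wpM2l// !mulrDr.
have : t * u ^+ 2 <= t * q1 by rewrite ler_pM2l.
have : 0 <= t * w by rewrite mulr_ge0// ltW.
by lra.
Qed.

End rademacher_menshov.

Section maximal_inequalities.
Context {d : measure_display} {T : measurableType d} {R : realType}.
Variable P : probability T R.

Local Notation E f := (Rintegral P setT f).
Local Notation integ f := (integrable P setT (EFin \o f)).
Local Notation pr A := (fine (P A)).
Local Notation mf f := (measurable_fun setT f).

Lemma markov (f : T -> R) (x : R) : (forall w, 0 <= f w) -> integ f -> 0 < x ->
  pr [set w | x < f w] <= E f / x.
Proof.
move=> f0 i x0.
have mA : measurable [set w | x < f w] by apply: measurable_gt; exact: integ_mf i.
rewrite ler_pdivlMr// -E_indic// mulrC -EZ; last exact: integ_indic.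
apply: E_le => //; first exact/integZ/integ_indic.
move=> w; rewrite indicE; have [|_] := boolP (w \in _); last by rewrite mulr0.
by rewrite inE /= => /ltW xf; rewrite mulr1.
Qed.

Variables (Z : nat -> T -> R) (V : R).
Local Notation D m n := (fun w => \sum_(m <= k < n) Z k w).
Hypothesis mZ : forall k, mf (Z k).
Hypothesis iD : forall m n, (m <= n)%N -> integ (fun w => D m n w ^+ 2).
Hypothesis VD : forall m n, (m <= n)%N -> E (fun w => D m n w ^+ 2) <= V * (n - m)%:R.

Lemma mD m n : mf (D m n).
Proof. exact: measurable_sum. Qed.

Lemma V_ge0 : 0 <= V.
Proof.
have := VD (leqnSn 0); rewrite mulr1; apply: le_trans.
by apply: E_ge0 => w; exact: sqr_ge0.
Qed.

Lemma pr_sum_gt (m n : nat) (x : R) : (m <= n)%N -> 0 < x ->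
  pr [set w | x < `|D m n w|] <= V * (n - m)%:R / x ^+ 2.
Proof.
move=> mn x0; apply: (le_trans (chebyshev_sqr (mD _ _) (iD mn) x0)).
by rewrite ler_pM2r ?invr_gt0 ?exprn_gt0// VD.
Qed.

(** The blocks of each of the [j.+1] levels have total length [2 ^ j]. *)
Lemma integ_dyadic_energy j a :
  integ (fun w => dyadic_energy (Z ^~ w) j a) /\
  E (fun w => dyadic_energy (Z ^~ w) j a) <= V * (j.+1 * 2 ^ j)%:R.
Proof.
elim: j a => [|j IH] a /=.
  under eq_fun do rewrite addr0; split; first by apply: iD; exact: leq_addr.
  by apply: (le_trans (VD (leq_addr _ _))); rewrite addKn mul1n.
have [i1 h1] := IH a; have [i2 h2] := IH (a + 2 ^ j)%N.
have i3 := iD (leq_addr (2 ^ j.+1) a).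
have h3 := VD (leq_addr (2 ^ j.+1) a).
have i4 := integD i1 i2.
split; first exact: integD.
rewrite (ED i3 i4) (ED i1 i2).
apply: (le_trans (lerD h3 (lerD h1 h2))).
rewrite addKn -!mulrDr -!natrD ler_wpM2l ?V_ge0// ler_nat.
by rewrite expnS; nia.
Qed.

(** Rademacher-Menshov: one factor [j.+1] comes from Cauchy-Schwarz along the levels, the other from
    the number of levels in the energy. *)
Lemma pr_max_dyadic j (x : R) : 0 < x ->
  pr (\big[setU/set0]_(i < (2 ^ j).+1) [set w | x < `|D 0%N i w|])
  <= V * (j.+1 ^ 2 * 2 ^ j)%:R / x ^+ 2.
Proof.
move=> x0; have [iQ EQ] := integ_dyadic_energy j 0.
have mA i : measurable [set w | x < `|D 0%N i w|].
  by apply: measurable_gt; apply: measurableT_comp => //; exact: mD.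
pose f w := j.+1%:R * dyadic_energy (Z ^~ w) j 0.
have i_f : integ f by exact: integZ.
have x2 : 0 < x ^+ 2 by rewrite exprn_gt0.
have mU : measurable (\big[setU/set0]_(i < (2 ^ j).+1) [set w | x < `|D 0%N i w|]).
  exact: bigsetU_measurable.
apply: (@le_trans _ _ (pr [set w | x ^+ 2 < f w])).
  apply: pr_le => //; first by apply: measurable_gt; exact: integ_mf i_f.
  rewrite -(bigcup_mkord _ (fun i => [set w | x < `|D 0%N i w|])) => w [i /=].
  rewrite ltnS => ij xi.
  apply: (@lt_le_trans _ _ ((\sum_(0 <= k < i) Z k w) ^+ 2)).
    by rewrite -(real_normK (num_real (\sum_(0 <= k < i) _))) ltrXn2r// ?nnegrE// ltW.
  exact: (@dyadic_maximal _ (Z ^~ w) j 0 i).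
have f0 w : 0 <= f w by rewrite mulr_ge0// dyadic_energy_ge0.
apply: (le_trans (markov f0 i_f x2)).
rewrite ler_pM2r ?invr_gt0// /f (EZ _ iQ).
rewrite -mulnn -mulnA [(j.+1 * (_ * _))%:R]natrM mulrCA ler_wpM2l//.
Qed.

End maximal_inequalities.

Section ottaviani.
Context {d : measure_display} {T : measurableType d} {R : realType}.
Variable P : probability T R.
Variable e : nat -> {RV P >-> R}.

Local Notation E f := (Rintegral P setT f).
Local Notation integ f := (integrable P setT (EFin \o f)).
Local Notation pr A := (fine (P A)).
Local Notation mf f := (measurable_fun setT f).
Local Notation alpha := (alpha_mix P (fun k => e k)).
Local Notation gs := (gen_sigma (fun k => e k)).
Local Notation adapted I X :=
  (measurable_fun (setT : set (g_sigma_algebraType (gens e I))) (X : T -> R)).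

Lemma adapted_e (I : set nat) i : I i -> adapted I (e i).
Proof. by move=> Ii _ B mB; rewrite setTI; exact: gs_preimage. Qed.

Lemma gs_adapted (I : set nat) (X : T -> R) (x : R) : adapted I X ->
  gs I [set w | x < `|X w|].
Proof.
move=> aX; apply: (@measurable_gt _ (g_sigma_algebraType (gens e I))).
exact: measurableT_comp.
Qed.

Variables (Z : nat -> T -> R) (V : R).
Local Notation D m n := (fun w => \sum_(m <= k < n) Z k w).
Hypothesis aZ : forall k (I : set nat), I k -> adapted I (Z k).
Hypothesis iD : forall m n, (m <= n)%N -> integ (fun w => D m n w ^+ 2).
Hypothesis VD : forall m n, (m <= n)%N -> E (fun w => D m n w ^+ 2) <= V * (n - m)%:R.

Let mZ k : mf (Z k).
Proof.
have aT : adapted setT (Z k) by exact: aZ.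
by move=> _ B mB; apply: (@gs_measurable _ _ _ P e setT); exact: aT.
Qed.

Lemma adapted_sum (I : set nat) m n : (forall k, (m <= k < n)%N -> I k) ->
  adapted I (D m n).
Proof.
move=> mnI; rewrite (_ : (D m n) =
    (fun w => \sum_(m <= k < n) (if (m <= k < n)%N then Z k w else 0))); last first.
  by apply/funext => w; rewrite big_nat big_nat; apply: eq_bigr => k ->.
apply: measurable_sum => k; have [/mnI Ik|_] := boolP (m <= k < n)%N; last exact: measurable_cst.
exact: aZ.
Qed.

(* On the first block j at which the threshold 3x is exceeded, one of the three
   pieces of D 0 (N l) = D 0 (j l) + D (j l) ((j+1) l) + D ((j+1) l) (N l) tells:
   either the sum ends above x, or the gap block or the far piece exceeds x; the
   gap block makes the far piece nearly independent of the stopping event. *)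
Lemma ottaviani (l N : nat) (x : R) : 0 < x ->
  pr (\big[setU/set0]_(j < N.+1) [set w | 3 * x < `|D 0%N (j * l)%N w|])
  <= 3 * (V * (N * l)%:R / x ^+ 2) + N%:R * alpha l.
Proof.
move=> x0.
have V0 : 0 <= V by exact: (V_ge0 VD).
have x2 : 0 < x ^+ 2 by rewrite exprn_gt0.
pose A j := [set w | 3 * x < `|D 0%N (j * l)%N w|].
pose B j := \big[setU/set0]_(i < j) A i.
pose U j := A j `\` B j.
pose G j := [set w | x < `|D (j * l)%N (j.+1 * l)%N w|].
pose F j := [set w | x < `|D (j.+1 * l)%N (N * l)%N w|].
pose H := [set w | x < `|D 0%N (N * l)%N w|].
have mS m n y : measurable [set w | y < `|D m n w|].
  apply: measurable_gt; apply: measurableT_comp => //; exact: measurable_sum.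
have mA j : measurable (A j) by exact: mS.
have mB j : measurable (B j) by exact: bigsetU_measurable.
have mU j : measurable (U j) by exact: measurableD.
have mG j : measurable (G j) by exact: mS.
have mF j : measurable (F j) by exact: mS.
have mH : measurable H by exact: mS.
have mUF j : measurable (U j `&` F j) by exact: measurableI.
have UB j : pr (U j) = pr (B j.+1) - pr (B j).
  rewrite -pr_setD//; last by rewrite /B big_ord_recr/=; exact: subsetUl.
  congr (fine (P _)); rewrite /U /B big_ord_recr /= setDUl setDv set0U.
  by [].
have telU : \sum_(j < N) pr (U j) <= 1.
  have -> : \sum_(j < N) pr (U j) = pr (B N).
    elim: (N) => [|n IH]; first by rewrite /B !big_ord0 measure0.
    by rewrite big_ord_recr/= IH UB addrC subrK.
  exact: pr_le1.
have sub : B N.+1 `<=` H `|` \big[setU/set0]_(j < N) (G j `|` (U j `&` F j)).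
  move=> w; rewrite /B -bigcup_mkord => -[j0 /= j0N Aj0].
  have ex : exists j, (j <= N)%N && `[< A j w >].
    by exists j0; apply/andP; split => //; exact/asboolP.
  have [j /andP[jN /asboolP Aj] jmin] := ex_minnP ex.
  have Uj : U j w.
    split=> //; rewrite /B -bigcup_mkord => -[i /= ij Ai].
    have := jmin i; rewrite (leq_trans (ltnW ij) jN) /= leqNgt ij.
    by move=> /(_ (asboolT Ai)).
  have [hH|nH] := pselect (H w); first by left.
  (* A first passage at the last block end already lies in H. *)
  have jN' : (j < N)%N.
    rewrite ltn_neqAle jN andbT; apply/eqP => jE; apply: nH.
    rewrite /H /= -jE; apply: le_lt_trans Aj.
    by lra.
  right; rewrite -(bigcup_mkord N (fun j => G j `|` (U j `&` F j))); exists j => //.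
  have [hG|nG] := pselect (G j w); first by left.
  right; split => //; apply: contrapT => nF.
  move: nH nG nF Aj => /negP; rewrite -leNgt => nH /negP; rewrite -leNgt => nG.
  move=> /negP; rewrite -leNgt => nF; apply/negP; rewrite -leNgt.
  have e1 : D 0%N (N * l)%N w = D 0%N (j * l)%N w + D (j * l)%N (N * l)%N w.
    by rewrite -big_cat_nat// leq_mul2r (ltnW jN') orbT.
  have e2 : D (j * l)%N (N * l)%N w = D (j * l)%N (j.+1 * l)%N w + D (j.+1 * l)%N (N * l)%N w.
    by rewrite -big_cat_nat// leq_mul2r ?leqnSn ?jN' orbT.
  have -> : D 0%N (j * l)%N w =
    D 0%N (N * l)%N w - D (j * l)%N (j.+1 * l)%N w - D (j.+1 * l)%N (N * l)%N w.
    by rewrite e1 e2; ring.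
  apply: (le_trans (ler_normB _ _)).
  have := ler_normB (D 0%N (N * l)%N w) (D (j * l)%N (j.+1 * l)%N w).
  by lra.
have bnd m n : (m <= n)%N -> (n <= N * l)%N ->
    pr [set w | x < `|D m n w|] <= V * (N * l)%:R / x ^+ 2.
  move=> mn nN; apply: (le_trans (pr_sum_gt mZ iD VD mn x0)).
  rewrite ler_pM2r ?invr_gt0// ler_wpM2l// ler_nat.
  by rewrite (leq_trans (leq_subr _ _)).
have gG j : pr (G j) <= V * l%:R / x ^+ 2.
  apply: (le_trans (pr_sum_gt mZ iD VD _ x0)); first by rewrite leq_mul2r leqnSn orbT.
  by rewrite -mulnBl subSnn mul1n.
have gUF (j : 'I_N) : pr (U j `&` F j) <= pr (U j) * (V * (N * l)%:R / x ^+ 2) + alpha l.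
  (* U_j looks at indices below j l and F_j at indices from j l + l on; the skipped block is the
     lag. *)
  have dUF : dependence P (U j) (F j) <= alpha l.
    apply: (@dependence_le_alpha _ _ _ P e (j * l)%N).
      have gA i : (i <= j)%N -> gs [set i | (i <= j * l)%N] (A i).
        move=> ij; apply: gs_adapted; apply: adapted_sum => k /andP[_ ki] /=.
        by rewrite (leq_trans (ltnW ki))// leq_mul2r ij orbT.
      pose TT := g_sigma_algebraType (gens e [set i | (i <= j * l)%N]).
      apply: (@measurableD _ TT); first exact: gA.
      rewrite /B; apply: (@bigsetU_measurable _ TT) => i _; apply: gA.
      exact/ltnW.
    apply: gs_adapted; apply: adapted_sum => k /andP[jk _] /=.
    by apply: leq_trans jk; rewrite mulSn addnC.
  have jN : (j.+1 <= N)%N := ltn_ord j.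
  have fF : pr (F j) <= V * (N * l)%:R / x ^+ 2.
    by apply: bnd => //; rewrite leq_mul2r jN orbT.
  move: dUF; rewrite /dependence => /(le_trans (ler_norm _)); rewrite lerBlDl => h.
  by apply: (le_trans h); rewrite lerD2r ler_wpM2l// pr_ge0.
have mGU j : measurable (G j `|` (U j `&` F j)) by exact: measurableU.
have mGUs : measurable (\big[setU/set0]_(j < N) (G j `|` (U j `&` F j))).
  exact: bigsetU_measurable.
apply: (@le_trans _ _ (pr (H `|` \big[setU/set0]_(j < N) (G j `|` (U j `&` F j))))).
  by apply: pr_le; [exact: (mB N.+1)|exact: measurableU|exact: sub].
apply: (le_trans (pr_leU P mH mGUs)).
apply: (le_trans (lerD (bnd 0%N (N * l)%N (leq0n _) (leqnn _)) (pr_le_bigU P N mGU))).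
set v := V * (N * l)%:R / x ^+ 2.
have v0 : 0 <= v by rewrite divr_ge0 ?mulr_ge0// ltW.
have s1 : \sum_(j < N) pr (G j `|` (U j `&` F j)) <=
   \sum_(j < N) (V * l%:R / x ^+ 2 + (pr (U j) * v + alpha l)).
  apply: ler_sum => j _; apply: (le_trans (pr_leU P (mG j) (mUF j))).
  exact: lerD.
(* Origin of the factor 3: one v from H, one from the N gap blocks together, and one from the far
   pieces, since the disjoint events U_j have total probability at most 1. *)
have s2 : \sum_(j < N) (V * l%:R / x ^+ 2 + (pr (U j) * v + alpha l)) =
   v + ((\sum_(j < N) pr (U j)) * v + N%:R * alpha l).
  rewrite !big_split /= mulr_suml !sumr_const !card_ord; congr (_ + (_ + _)).
    by rewrite /v natrM -mulr_natl; ring.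
  by rewrite mulr_natl.
have s3 : (\sum_(j < N) pr (U j)) * v <= 1 * v by rewrite ler_wpM2r.
by lra.
Qed.

End ottaviani.

(** * Maximum of the noise partial sums *)

Section noise_maximum.
Context {d : measure_display} {T : measurableType d} {R : realType}.
Variable P : probability T R.
Variable e : nat -> {RV P >-> R}.

Local Notation E f := (Rintegral P setT f).
Local Notation integ f := (integrable P setT (EFin \o f)).
Local Notation pr A := (fine (P A)).
Local Notation mf f := (measurable_fun setT f).
Local Notation alpha := (alpha_mix P (fun k => e k)).

Variables (p A t S : R).
Hypothesis p2 : 2 < p.
Hypothesis ip : forall i, integ (fun w => `|e i w| `^ p).
Hypothesis Ep : forall i, E (fun w => `|e i w| `^ p) <= A.
Hypothesis e_mean0 : forall i, E (e i) = 0.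
Hypothesis t01 : 0 <= t <= 1.
Hypothesis aS : forall n,
  \sum_(0 <= k < n) alpha k `^ ((1 - 2 / p) * (1 - t)) <= S.

Variables (s : nat -> R) (K : R).
Hypothesis sK : forall k, `|s k| <= K.

Let A0 : 0 <= A.
Proof. by apply: le_trans (Ep 0); apply: E_ge0 => w; exact: powR_ge0. Qed.

Let S0 : 0 <= S.
Proof. by have := aS 0; rewrite big_nil. Qed.

Let K0 : 0 <= K.
Proof. exact: le_trans (sK 0). Qed.

(** The constant of [cov_interpolation] at M = 1 + A, times the bound 2 S on each row of the
    covariance matrix. *)
Definition var_const : R := (4 + (4 + A) * A + 2 * (1 + A)) * (2 * S).

Let C0 : 0 <= 4 + (4 + A) * A + 2 * (1 + A).
Proof. by rewrite !addr_ge0// mulr_ge0// addr_ge0. Qed.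

Lemma var_const_ge0 : 0 <= var_const.
Proof. by rewrite mulr_ge0// mulr_ge0. Qed.

(** Truncation destroys the centering of [e k], so each part is recentered; the means of the low and
    high parts cancel because [e k] has mean 0. *)
Definition part (f : R -> R) (k : nat) (w : T) : R := s k * (f (e k w) - E (f \o e k)).

Section parts.
Variable f : R -> R.
Hypothesis mf : mf f.
Hypothesis fx : forall x, `|f x| <= `|x|.

Let me l : measurable_fun setT (f \o e l).
Proof. exact: measurableT_comp. Qed.

Lemma integ_part l : integ (f \o e l).
Proof. by apply: (integ_dom1 p2 ip (me l)) => w; exact: fx. Qed.

Lemma part_var (x : R) : 0 <= x ->
  (forall j, E (fun w => f (e j w) ^+ 2) <= (1 + A) * x) ->
  forall m n, (m <= n)%N ->
  integ (fun w => (\sum_(m <= k < n) part f k w) ^+ 2) /\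
  E (fun w => (\sum_(m <= k < n) part f k w) ^+ 2)
    <= K ^+ 2 * var_const * x `^ t * (n - m)%:R.
Proof.
move=> x0 fM m n mn.
have i2 l k : integ (fun w => f (e l w) * f (e k w)).
  by apply: (integ_mul_dom p2 ip (me l) (me k)) => w; exact: fx.
pose X k w := f (e k w) - E (f \o e k).
have XX i j := E_centered_mul (integ_part i) (integ_part j) (i2 i j).
have a0 k : 0 <= alpha k `^ ((1 - 2 / p) * (1 - t)) by exact: powR_ge0.
have c0 : 0 <= (4 + (4 + A) * A + 2 * (1 + A)) * x `^ t by rewrite mulr_ge0// powR_ge0.
have cX i k : `|E (fun w => X i w * X (i + k)%N w)| <=
    (4 + (4 + A) * A + 2 * (1 + A)) * x `^ t * alpha k `^ ((1 - 2 / p) * (1 - t)).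
  rewrite (XX i (i + k)%N).2 -mulrA.
  by apply: (cov_interpolation p2 ip Ep) => //; rewrite addr_ge0.
have [h1 h2] := variance_sum_le mn (fun i j => (XX i j).1) cX c0 a0 aS sK.
split => //; apply: (le_trans h2); rewrite le_eqVlt; apply/orP; left; apply/eqP.
by rewrite /var_const; ring.
Qed.

Lemma part_adapted k (I : set nat) : I k ->
  measurable_fun (setT : set (g_sigma_algebraType (gens e I))) (part f k : T -> R).
Proof.
move=> Ik; apply: measurable_funM => //; apply: measurable_funB => //.
apply: measurableT_comp; first exact: mf.
exact: (@adapted_e _ _ _ P e).
Qed.

Lemma measurable_part k : measurable_fun setT (part f k).
Proof.
by apply: measurable_funM => //; apply: measurable_funB => //; exact: me.
Qed.

End parts.

Definition low (b : R) := truncate b (@id R).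
Definition high (b : R) (x : R) : R := x - low b x.

Lemma measurable_low b : mf (low b).
Proof. by apply: measurable_truncate; exact: measurable_id. Qed.

Lemma measurable_high b : mf (high b).
Proof. by apply: measurable_funB; [exact: measurable_id|exact: measurable_low]. Qed.

Lemma low_le b x : `|low b x| <= `|x|.
Proof. by apply: truncate_le. Qed.

Lemma high_le b x : `|high b x| <= `|x|.
Proof. by rewrite /high /low /truncate; case: ifP => _; rewrite ?subrr ?normr0 ?subr0. Qed.

Lemma sqr_high b x : high b x ^+ 2 = tail_sqr b x.
Proof.
by rewrite /high /low /truncate /tail_sqr; case: ifP => _; rewrite ?subrr ?expr0n ?subr0.
Qed.

Lemma part_low_high b k w : s k * e k w = part (low b) k w + part (high b) k w.
Proof.
have iL := integ_part (measurable_low b) (low_le b) k.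
have iH := integ_part (measurable_high b) (high_le b) k.
have : E (low b \o e k) + E (high b \o e k) = 0.
  rewrite -ED// -[RHS](e_mean0 k); congr (Rintegral _ _ _).
  by apply/funext => v; rewrite /high /= addrC subrK.
have highE : high b (e k w) = e k w - low b (e k w) by [].
rewrite /part -mulrDr highE => h.
have -> : low b (e k w) - E (low b \o e k) + (e k w - low b (e k w) - E (high b \o e k))
   = e k w - (E (low b \o e k) + E (high b \o e k)) by ring.
by rewrite h subr0.
Qed.

Lemma low_var (b : R) m n : (m <= n)%N ->
  integ (fun w => (\sum_(m <= k < n) part (low b) k w) ^+ 2) /\
  E (fun w => (\sum_(m <= k < n) part (low b) k w) ^+ 2)
    <= K ^+ 2 * var_const * (n - m)%:R.
Proof.
move=> mn; have iS := integ_sqr p2 ip.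
have h w j : low b (e j w) ^+ 2 <= e j w ^+ 2.
  rewrite -(real_normK (num_real (low _ _))) -(real_normK (num_real (e j w))).
  by rewrite lerXn2r ?nnegrE//; exact: low_le.
have h1 j : E (fun w => low b (e j w) ^+ 2) <= (1 + A) * 1.
  rewrite mulr1; apply: le_trans (E_sqr_le p2 ip Ep j).
  apply: E_le => //; apply: (integ_dom _ (iS j)).
    apply: measurable_funX; apply: measurableT_comp => //; exact: measurable_low.
  by move=> w; rewrite ger0_norm ?sqr_ge0.
by have := part_var (measurable_low b) (low_le b) ler01 h1 mn; rewrite powR1 mulr1.
Qed.

(** The negative power of b is the gain that has to absorb the squared logarithm of
    [pr_max_dyadic]. *)
Lemma high_var (b : R) m n : 0 < b -> (m <= n)%N ->
  integ (fun w => (\sum_(m <= k < n) part (high b) k w) ^+ 2) /\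
  E (fun w => (\sum_(m <= k < n) part (high b) k w) ^+ 2)
    <= K ^+ 2 * var_const * (b `^ (2 - p)) `^ t * (n - m)%:R.
Proof.
move=> b0 mn; apply: (part_var (measurable_high b) (high_le b)) => //; first exact: powR_ge0.
move=> j; under eq_fun do rewrite sqr_high.
apply: (le_trans (E_tail_sqr p2 ip Ep j b0)); rewrite mulrC ler_wpM2r ?powR_ge0//.
by rewrite lerDr.
Qed.

Lemma part_low_bound (b : R) k w : 0 <= b -> `|part (low b) k w| <= K * (2 * b).
Proof.
move=> b0; rewrite normrM ler_pM//; apply: (le_trans (ler_normB _ _)).
have lb x : `|low b x| <= b by exact: truncate_bound.
rewrite mulr_natl mulr2n lerD//.
rewrite -[leRHS](E_cst P); apply: E_abs_le.
- exact: (integ_part (measurable_low b) (low_le b)).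
- exact: integ_cst.
- by move=> v; exact: lb.
Qed.

(* For n ~ 2^(16h): truncation level b = 2^h, block length l = 2^(6h). Then l b is
   negligible against sqrt n, and (n / l) alpha(l) = O(n l^-3) tends to 0. *)
Lemma pr_noise_maximum (n h : nat) (y : R) :
  (2 ^ (16 * h) <= n)%N -> (n <= 2 ^ (16 * h.+1))%N ->
  0 < y -> 16 * K * 2 ^+ (7 * h) <= y ->
  pr (\big[setU/set0]_(i < n.+1) [set w | y < `|\sum_(0 <= k < i) s k * e k w|])
  <= K ^+ 2 * var_const * ((2 ^+ h) `^ (2 - p)) `^ t *
       ((16 * h.+1).+1 ^ 2 * 2 ^ (16 * h.+1))%:R / (y / 2) ^+ 2
     + (3 * (K ^+ 2 * var_const * n%:R / (y / 8) ^+ 2)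
        + n%:R / 2 ^+ (6 * h) * alpha (2 ^ (6 * h))%N).
Proof.
move=> hn nh y0 Ky.
set b : R := 2 ^+ h; set l := (2 ^ (6 * h))%N; set N := (n %/ l)%N.
have b0 : 0 < b by rewrite exprn_gt0.
have l0 : (0 < l)%N by rewrite expn_gt0.
have V0 : 0 <= K ^+ 2 * var_const by rewrite mulr_ge0 ?sqr_ge0// var_const_ge0.
pose L i w := \sum_(0 <= k < i) part (low b) k w.
pose H i w := \sum_(0 <= k < i) part (high b) k w.
have mLl m m' := measurable_sum (index_iota m m') (measurable_part (measurable_low b)).
have mHh m m' := measurable_sum (index_iota m m') (measurable_part (measurable_high b)).
have mU (F : nat -> T -> R) q x : (forall i, mf (F i)) ->
    measurable (\big[setU/set0]_(i < q) [set w | x < `|F i w|]).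
  move=> mF; apply: bigsetU_measurable => i _; apply: measurable_gt.
  exact: measurableT_comp.
(* The level y is shared out as y/2 for the high part, 3y/8 for the low part at block ends, and y/8
   for the low part inside the incomplete block. *)
set UH := \big[setU/set0]_(i < (2 ^ (16 * h.+1)).+1) [set w | y / 2 < `|H i w|].
set UL := \big[setU/set0]_(j < N.+1) [set w | 3 * (y / 8) < `|L (j * l)%N w|].
have mUH : measurable UH by apply: mU => i; exact: mHh.
have mUL : measurable UL by apply: (mU (fun j => L (j * l)%N)) => i; exact: mLl.
have sub : \big[setU/set0]_(i < n.+1) [set w | y < `|\sum_(0 <= k < i) s k * e k w|]
    `<=` UH `|` UL.
  rewrite -(bigcup_mkord _ (fun i => [set w | y < `|\sum_(0 <= k < i) s k * e k w|])).
  move=> w [i /= iN yi]; rewrite ltnS in iN.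
  have split_ : \sum_(0 <= k < i) s k * e k w = L i w + H i w.
    by rewrite -big_split /=; apply: eq_bigr => k _; exact: part_low_high.
  have [hH|hH] := ltP (y / 2) `|H i w|.
    left; rewrite /UH -(bigcup_mkord _ (fun i => [set w | y / 2 < `|H i w|])).
    by exists i => //=; rewrite ltnS (leq_trans iN).
  right; rewrite /UL -(bigcup_mkord _ (fun j => [set w | 3 * (y / 8) < `|L (j * l)%N w|])).
  exists (i %/ l)%N => /=; first by rewrite ltnS leq_div2r.
  have iE : L i w = L (i %/ l * l)%N w + \sum_((i %/ l * l)%N <= k < i) part (low b) k w.
    by rewrite /L -big_cat_nat// leq_divM.
  (* Fewer than l terms, each at most 2 K b, with l b = 2^(7h); the hypothesis with 16 = 8 * 2 is
     made for this. *)
  have rem : `|\sum_((i %/ l * l)%N <= k < i) part (low b) k w| <= y / 8.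
    apply: (le_trans (ler_norm_sum _ _ _)).
    apply: (@le_trans _ _ (\sum_((i %/ l * l)%N <= k < i) K * (2 * b))).
      by apply: ler_sum => k _; apply: part_low_bound; exact: ltW.
    rewrite sumr_const_nat -[leLHS]mulr_natr.
    apply: (@le_trans _ _ (K * (2 * b) * l%:R)).
      have Kb : 0 <= K * (2 * b) by rewrite !mulr_ge0// ltW.
      rewrite ler_wpM2l// ler_nat.
      by rewrite leq_subLR {1}(divn_eq i l) leq_add2l ltnW// ltn_mod.
    have -> : K * (2 * b) * l%:R = 2 * K * 2 ^+ (7 * h).
      rewrite /l natrX (_ : 7 * h = h + 6 * h)%N ?exprD; last by rewrite -mulSn.
      by rewrite /b; ring.
    by move: Ky; set z := 2 ^+ _; lra.
  move: yi; rewrite split_ => yi.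
  have := ler_normD (L i w) (H i w).
  have := ler_normD (L (i %/ l * l)%N w) (\sum_((i %/ l * l)%N <= k < i) part (low b) k w).
  rewrite -iE.
  by lra.
have mBad : measurable (\big[setU/set0]_(i < n.+1)
    [set w | y < `|\sum_(0 <= k < i) s k * e k w|]).
  apply: (mU (fun i w => \sum_(0 <= k < i) s k * e k w)) => i.
  by apply: measurable_sum => k; exact: measurable_funM.
apply: (le_trans (pr_le P mBad (measurableU _ _ mUH mUL) sub)).
apply: (le_trans (pr_leU P mUH mUL)).
have y2 : 0 < y / 2 by rewrite divr_gt0.
have y8 : 0 < y / 8 by rewrite divr_gt0.
apply: lerD.
  exact: (pr_max_dyadic (measurable_part (measurable_high b))
    (fun m n mn => (high_var b0 mn).1) (fun m n mn => (high_var b0 mn).2) _ y2).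
apply: (le_trans (ottaviani (part_adapted (measurable_low b))
    (fun m n mn => (low_var b mn).1) (fun m n mn => (low_var b mn).2) l N y8)).
apply: lerD.
  rewrite ler_wpM2l// ler_pM2r ?invr_gt0 ?exprn_gt0// ler_wpM2l// ler_nat.
  exact: leq_divM.
rewrite ler_wpM2r ?alpha_ge0// ler_pdivlMr ?exprn_gt0//.
by rewrite -natrX -natrM ler_nat leq_divM.
Qed.

End noise_maximum.

(** * Limits *)

Lemma bernoulli_ineq {R : realDomainType} (x : R) (n : nat) : 0 <= x ->
  1 + n%:R * x <= (1 + x) ^+ n.
Proof.
move=> x0; elim: n => [|n IH]; first by rewrite mul0r addr0.
rewrite exprS; apply: (@le_trans _ _ ((1 + x) * (1 + n%:R * x))); last first.
  by rewrite ler_wpM2l// addr_ge0.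
rewrite -natr1; have : 0 <= n%:R * (x * x) by rewrite !mulr_ge0.
by lra.
Qed.

(** Bernoulli's inequality for sqrt q gives a linear lower bound on its powers; squaring it
    dominates a quadratic term. *)
Lemma sqr_le_expr {R : realType} (q : R) : 1 < q ->
  exists2 C, 0 <= C & forall h, ((16 * h.+1).+1 ^ 2)%:R <= C * q ^+ h.
Proof.
move=> q1; have q0 : 0 <= q by rewrite ltW// (lt_trans _ q1).
pose x := Num.sqrt q - 1.
have x0 : 0 < x by rewrite subr_gt0 -(sqrtr1 R) ltr_sqrt// (lt_trans _ q1).
pose c := 17 + 16 / x.
have c0 : 0 <= c by rewrite addr_ge0// divr_ge0// ltW.
exists (c ^+ 2); first exact: sqr_ge0.
move=> h; have qE : q = (1 + x) ^+ 2 by rewrite /x addrC subrK sqr_sqrtr.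
apply: (@le_trans _ _ ((c * (1 + x) ^+ h) ^+ 2)); last first.
  by rewrite exprMn -exprM mulnC exprM -qE.
have x1 : 0 <= 1 + x by rewrite addr_ge0// ltW.
have cx : 0 <= c * (1 + x) ^+ h by rewrite mulr_ge0// exprn_ge0.
rewrite natrX lerXn2r ?nnegrE ?ler0n//.
apply: (@le_trans _ _ (c * (1 + h%:R * x))); last first.
  by rewrite ler_wpM2l// bernoulli_ineq// ltW.
have -> : c * (1 + h%:R * x) = 17 + 16 * h%:R + (17 * (h%:R * x) + 16 / x).
  by rewrite /c; field; rewrite gt_eqF.
have -> : (16 * h.+1).+1%:R = 17 + 16 * h%:R :> R.
  by rewrite -[LHS]natr1 natrM -[h.+1%:R]natr1; ring.
rewrite lerDl addr_ge0//; first by rewrite !mulr_ge0// ltW.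
by rewrite divr_ge0// ltW.
Qed.

Section noise_limit.
Context {d : measure_display} {T : measurableType d} {R : realType}.
Variable P : probability T R.
Variable e : nat -> {RV P >-> R}.

Local Notation E f := (Rintegral P setT f).
Local Notation integ f := (integrable P setT (EFin \o f)).
Local Notation pr A := (fine (P A)).
Local Notation mf f := (measurable_fun setT f).
Local Notation alpha := (alpha_mix P (fun k => e k)).

Variables (p A t S Ca : R).
Hypothesis p2 : 2 < p.
Hypothesis ip : forall i, integ (fun w => `|e i w| `^ p).
Hypothesis Ep : forall i, E (fun w => `|e i w| `^ p) <= A.
Hypothesis e_mean0 : forall i, E (e i) = 0.
Hypothesis t0 : 0 < t.
Hypothesis t1 : t <= 1.
Hypothesis aS : forall n,
  \sum_(0 <= k < n) alpha k `^ ((1 - 2 / p) * (1 - t)) <= S.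
Hypothesis alpha2 : forall n, n%:R ^+ 2 * alpha n <= Ca.

(** With lam_n = |delta_n| sqrt n the threshold is c lam_n sqrt n. The factor n then cancels in both
    Chebyshev terms, which become O(lam_n^-2), and the mixing term is O(2^-h). *)
Lemma noise_negligible (delta : nat -> R) (s : nat -> nat -> R) (K c eta : R) :
  assumption_C delta -> (forall n k, `|s n k| <= K) -> 0 < c -> 0 < eta ->
  exists N, forall n, (N <= n)%N -> 0 < c * (`|delta n| * n%:R) /\
   pr (\big[setU/set0]_(i < n.+1)
     [set w | c * (`|delta n| * n%:R) < `|\sum_(0 <= k < i) s n k * e k w|]) <= eta.
Proof.
move=> dC sK c0 eta0.
have t01 : 0 <= t <= 1 by rewrite (ltW t0).
have Ca0 : 0 <= Ca.
  by apply: le_trans (alpha2 0); rewrite mulr_ge0 ?alpha_ge0// sqr_ge0.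
have K0 : 0 <= K := le_trans (normr_ge0 _) (sK 0%N 0%N).
have [V VE] : exists V, V = K ^+ 2 * var_const A S by eexists.
have V0 : 0 <= V by rewrite VE mulr_ge0 ?sqr_ge0//; exact: (var_const_ge0 Ep aS).
have k0 : 0 < (p - 2) * t by rewrite mulr_gt0// subr_gt0.
(* At truncation level 2^h the gain on the tails is exactly q^-h. *)
pose q := 2 `^ ((p - 2) * t) : R.
have q1 : 1 < q.
  by have := @gt0_ltr_powR R _ k0 1 2; rewrite powR1; apply; rewrite ?nnegrE ?ltr1n.
have [C C0 hC] := sqr_le_expr q1.
have c16 : exists2 z : R, 0 < z & forall h, 2 ^+ (16 * h.+1) = z * 2 ^+ (16 * h).
  exists (2 ^+ 16); first by rewrite exprn_gt0.
  by move=> h; rewrite mulnS exprD.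
have {c16} [z z0 hz] := c16.
(* G collects both Chebyshev terms: 4 comes from the level y/2, and 192 = 3 * 8^2 from the three
   terms at level y/8. *)
have [G GE] : exists G, G = (4 * V * C * z + 192 * V) / c ^+ 2 by eexists.
have [H HE] : exists H, H = z * Ca by eexists.
have z0' := ltW z0.
have G0 : 0 <= G.
  rewrite GE; apply: divr_ge0; last exact: sqr_ge0.
  by apply: addr_ge0; [rewrite !mulr_ge0|rewrite mulr_ge0// ler0n].
have H0 : 0 <= H by rewrite HE mulr_ge0.
have [h0 hh0] : exists h0 : nat, 2 * H / eta <= h0%:R.
  by exists (Num.truncn (2 * H / eta)).+1; exact/ltW/truncnS_gt.
pose lam n := `|delta n| * Num.sqrt n%:R.
have [N1 _ hN1] : \forall n \near \oo, Num.max (16 * K / c) (1 + 2 * G / eta) <= lam n.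
  by move/cvgryPge: dC; exact.
exists (maxn N1 (2 ^ (16 * h0.+1))) => n; rewrite geq_max => /andP[/hN1 lKG nh0].
(* The first bound yields 16 K 2^(7h) <= y, as 2^(8h) <= sqrt n. The second yields lam n >= 1, so
   that G / lam^2 <= G / lam <= eta / 2. *)
have /andP[lK lG] : (16 * K / c <= lam n) && (1 + 2 * G / eta <= lam n).
  by rewrite -ge_max.
have [l lE] : exists l, l = lam n by eexists.
rewrite -lE in lK lG.
have lam0 : 1 <= l.
  by apply: le_trans lG; rewrite lerDl divr_ge0 ?mulr_ge0// ltW.
have n0 : (0 < n)%N by apply: leq_trans nh0; rewrite expn_gt0.
pose h := (trunc_log 2 n %/ 16)%N.
have /andP[tl1 tl2] := trunc_log_bounds (isT : (1 < 2)%N) n0.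
have hn : (2 ^ (16 * h) <= n)%N.
  by apply: leq_trans tl1; rewrite leq_exp2l// mulnC leq_divM.
have nh : (n <= 2 ^ (16 * h.+1))%N.
  by apply: (leq_trans (ltnW tl2)); rewrite leq_exp2l// mulnC ltn_ceil.
have h0h : (h0 <= h)%N.
  have : (2 ^ (16 * h0.+1) <= 2 ^ (16 * h.+1))%N by exact: leq_trans nh.
  by rewrite leq_exp2l// leq_mul2l ltnS.
have nR : 0 < n%:R :> R by rewrite ltr0n.
have sq0 : 0 < Num.sqrt n%:R :> R by rewrite sqrtr_gt0.
set y := c * (`|delta n| * n%:R).
have yE : y = c * l * Num.sqrt n%:R.
  by rewrite /y lE /lam -{1}(sqr_sqrtr (ltW nR)); ring.
have y2E : y ^+ 2 = c ^+ 2 * l ^+ 2 * n%:R.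
  by rewrite yE !exprMn (sqr_sqrtr (ltW nR)).
have lamp : 0 < l by exact: lt_le_trans lam0.
have y0 : 0 < y by rewrite yE !mulr_gt0.
split => //.
have Ky : 16 * K * 2 ^+ (7 * h) <= y.
  rewrite yE ler_pM ?mulr_ge0 ?exprn_ge0//.
    by rewrite [leRHS]mulrC -ler_pdivrMr.
  apply: (@le_trans _ _ (2 ^+ (8 * h))).
    by rewrite ler_eXn2l ?ltr1n// leq_mul2r orbT.
  rewrite -[leLHS](@ger0_norm _) ?exprn_ge0// -sqrtr_sqr ler_sqrt//.
  by rewrite -exprM mulnC mulnA -natrX ler_nat.
apply: (le_trans (pr_noise_maximum p2 ip Ep e_mean0 t01 aS (sK n) hn nh y0 Ky)).
rewrite -VE.
have -> : ((2 ^+ h) `^ (2 - p)) `^ t = (q ^+ h)^-1.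
  rewrite -powR_mulrn ?ler0n// -!powRrM -powR_mulrn ?powR_ge0// /q -powRrM -powRN.
  by congr (_ `^ _); ring.
have qh0 : 0 < q ^+ h by rewrite exprn_gt0// (lt_trans _ q1).
have e1 : V / q ^+ h * ((16 * h.+1).+1 ^ 2 * 2 ^ (16 * h.+1))%:R / (y / 2) ^+ 2
    <= 4 * V * C * z / c ^+ 2 / l ^+ 2.
  apply: (@le_trans _ _ (V / q ^+ h * (C * q ^+ h * (z * n%:R)) / (y / 2) ^+ 2)).
    rewrite ler_wpM2r ?invr_ge0 ?sqr_ge0// ler_wpM2l ?divr_ge0 ?(ltW qh0)//.
    rewrite natrM ler_pM// natrX hz ler_wpM2l ?(ltW z0)//.
    by rewrite -natrX ler_nat.
  rewrite le_eqVlt; apply/orP; left; apply/eqP.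
  rewrite exprMn y2E; field.
  by rewrite !gt_eqF.
have e2 : 3 * (V * n%:R / (y / 8) ^+ 2) = 192 * V / c ^+ 2 / l ^+ 2.
  by rewrite exprMn y2E; field; rewrite !gt_eqF.
(* The quadratic decay of alpha contributes 2^(-12h), and 16 - 6 - 12 = -2. *)
have e3 : n%:R / 2 ^+ (6 * h) * alpha (2 ^ (6 * h))%N <= H / 2 ^+ h.
  have b0 m : 0 < 2 ^+ m :> R by rewrite exprn_gt0.
  have al : alpha (2 ^ (6 * h))%N <= Ca / (2 ^+ (6 * h)) ^+ 2.
    by rewrite ler_pdivlMr ?exprn_gt0// mulrC -natrX alpha2.
  apply: (@le_trans _ _ (z * 2 ^+ (16 * h) / 2 ^+ (6 * h) * (Ca / (2 ^+ (6 * h)) ^+ 2))).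
    rewrite ler_pM ?alpha_ge0 ?divr_ge0 ?(ltW (b0 _))//.
    by rewrite ler_pM2r ?invr_gt0// -hz -natrX ler_nat.
  have -> : z * 2 ^+ (16 * h) / 2 ^+ (6 * h) * (Ca / (2 ^+ (6 * h)) ^+ 2) = H / 2 ^+ (2 * h).
    have eM m : 2 ^+ (m * h) = (2 ^+ h) ^+ m :> R by rewrite mulnC exprM.
    rewrite !eM HE; field.
    by rewrite gt_eqF.
  rewrite ler_wpM2l// lef_pV2 ?posrE// ler_eXn2l ?ltr1n//.
  by rewrite leq_pmull.
have e4 : H / 2 ^+ h <= eta / 2.
  rewrite ler_pdivrMr ?exprn_gt0//.
  have hh : 2 * H / eta <= h%:R by apply: (le_trans hh0); rewrite ler_nat.
  have h2h : h%:R <= 2 ^+ h :> R by rewrite -natrX ler_nat ltnW// ltn_expl.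
  by have := le_trans hh h2h; rewrite ler_pdivrMr//; lra.
have e5 : G / l ^+ 2 <= eta / 2.
  rewrite ler_pdivrMr ?exprn_gt0//.
  have : G <= eta / 2 * l.
    have : 2 * G / eta <= l by lra.
    by rewrite ler_pdivrMr//; lra.
  move/le_trans; apply; rewrite ler_wpM2l ?divr_ge0 ?(ltW eta0)//.
  by rewrite expr2 ler_peMr// ltW.
have GE2 : 4 * V * C * z / c ^+ 2 / l ^+ 2 + 192 * V / c ^+ 2 / l ^+ 2 = G / l ^+ 2.
  by rewrite GE -!mulrDl.
by rewrite e2; lra.
Qed.

Lemma alpha_small (eps : R) : 0 < eps -> exists k, alpha k <= eps.
Proof.
move=> eps0; pose k := (Num.truncn (Ca / eps)).+1.
have k0 : 0 < k%:R :> R by rewrite ltr0n.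
exists k; have := alpha2 k.
rewrite -ler_pdivlMl ?exprn_gt0// => /le_trans; apply.
rewrite mulrC ler_pdivrMr ?exprn_gt0// mulrC -ler_pdivrMr//.
apply: (le_trans (ltW (truncnS_gt _))).
by rewrite -natrX ler_nat -/k -mulnn leq_pmulr.
Qed.

(** * Persistence of the noise in a fixed set *)

Definition all_in (B : set R) (m : nat) : set T :=
  [set w | forall i, (i < m)%N -> B (e i w)].

Lemma all_inS B m : all_in B m.+1 = all_in B m `&` e m @^-1` B.
Proof.
apply/seteqP; split => [w h|w [h1 h2] i].
  by split => [i im|]; apply: h => //; exact: ltnW.
by rewrite ltnS leq_eqVlt => /predU1P[->//|]; exact: h1.
Qed.

Lemma gs_all_in B (I : set nat) m : measurable B -> (forall i, (i < m)%N -> I i) ->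
  gen_sigma (fun k => e k) I (all_in B m).
Proof.
move=> mB; elim: m => [_|m IH mI].
  rewrite (_ : all_in B 0 = setT); last by apply/seteqP; split.
  exact: (@measurableT _ (g_sigma_algebraType (gens e I))).
rewrite all_inS; apply: (@measurableI _ (g_sigma_algebraType (gens e I))).
  by apply: IH => i im; apply: mI; exact: ltnW.
by apply: (@gs_preimage _ _ _ P e) => //; exact: mI.
Qed.

Lemma measurable_all_in B m : measurable B -> measurable (all_in B m).
Proof.
by move=> mB; apply: (@gs_measurable _ _ _ P e setT); exact: gs_all_in.
Qed.

Hypothesis stat : strictly_stationary P (fun k => e k).

(* u_m = P(e_0, .., e_(m-1) in B) satisfies u_(m+k+1) <= a u_m + alpha k, so its
   infimum L satisfies L <= a L. *)
Lemma pr_all_in (B : set R) (eta : R) : measurable B ->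
  pr (e 0%N @^-1` B) < 1 -> 0 < eta ->
  exists N, forall m, (N <= m)%N -> pr (all_in B m) <= eta.
Proof.
move=> mB a1 eta0; set a := pr _ in a1.
pose u m := pr (all_in B m).
have mA m := measurable_all_in m mB.
have me i : measurable (e i @^-1` B) by rewrite -[_ @^-1` _]setTI; exact: measurable_funP.
have a0 : 0 <= a by exact: pr_ge0.
have u0 m : 0 <= u m by exact: pr_ge0.
have uanti m n : (m <= n)%N -> u n <= u m.
  by move=> mn; apply: pr_le => // w h i im; apply: h; exact: leq_trans mn.
(* Forget the indices from m to m + k - 1: the last variable is then nearly independent of the first
   m. *)
have rec m k : u (m + k).+1 <= a * u m + alpha k.
  apply: (@le_trans _ _ (pr (all_in B m `&` e (m + k)%N @^-1` B))).
    apply: pr_le => //; first exact: measurableI.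
    by move=> w h; split => [i im|]; apply: h => //; rewrite ltnS (leq_trans (ltnW im))// leq_addr.
  have : dependence P (all_in B m) (e (m + k)%N @^-1` B) <= alpha k.
    apply: (@dependence_le_alpha _ _ _ P e m).
      by apply: gs_all_in => // i /ltnW.
    by apply: (@gs_preimage _ _ _ P e) => /=.
  rewrite /dependence (stationary1 stat _ mB) -/a => /(le_trans (ler_norm _)).
  by rewrite lerBlDl mulrC.
apply: contrapT => /forallNP nN.
have ueta m : eta < u m.
  have /existsNP[n /not_implyP[mn /negP]] := nN m.
  by rewrite -ltNge => /lt_le_trans; apply; exact: uanti.
have hi : has_inf (range u).
  by split; [exists (u 0%N), 0%N|exists 0 => _ [m _ <-]].
pose L := inf (range u).
have Leta : eta <= L.
  by apply: lb_le_inf; [exists (u 0%N), 0%N|move=> _ [m _ <-]; exact/ltW].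
have L0 : 0 < L by exact: lt_le_trans Leta.
(* The recursion will give L <= a (L + x) + x <= a L + 2 x, while L - a L = 4 x > 0. *)
pose x := (1 - a) * L / 4.
have x0 : 0 < x by rewrite divr_gt0// mulr_gt0// subr_gt0.
have [k ak] := alpha_small x0.
have [_ [m _ <-] um] := inf_adherent x0 hi.
have Lu : L <= u (m + k).+1 by apply: ge_inf; [exact: hi.2|exists (m + k).+1].
have : L <= a * u m + alpha k := le_trans Lu (rec m k).
have : a * u m <= a * (L + x) by rewrite ler_wpM2l// ltW.
have : a * x <= x by rewrite ler_piMl// ltW.
rewrite -/L in um *; rewrite mulrDr.
have xE : 4 * x = L - a * L by rewrite /x; field.
by lra.
Qed.

End noise_limit.

Section sign.
Context {d : measure_display} {T : measurableType d} {R : realType}.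
Variable P : probability T R.
Local Notation E f := (Rintegral P setT f).
Local Notation integ f := (integrable P setT (EFin \o f)).
Local Notation pr A := (fine (P A)).

(** A variable that is almost surely nonnegative with mean 0 vanishes almost surely, hence has zero
    second moment. *)
Lemma pr_ge0_lt1 (X : T -> R) : integ X -> E X = 0 ->
  (\int[P]_w (X w ^+ 2)%:E != 0)%E -> pr [set w | 0 <= X w] < 1.
Proof.
move=> iX EX X2; have mX := integ_mf iX.
have mA : measurable [set w | 0 <= X w] by exact: measurable_ge.
rewrite lt_neqAle pr_le1// andbT; apply/eqP => p1; move/eqP: X2; apply.
have N0 : P (~` [set w | 0 <= X w]) = 0%E.
  rewrite probability_setC//.
  rewrite -[P [set w | 0 <= X w]]fineK ?fin_num_measure// p1.
  by rewrite subee.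
have ae0 : {ae P, forall w, setT w -> (`|X w|)%:E = (X w)%:E}.
  exists (~` [set w | 0 <= X w]); split => //; first exact: measurableC.
  by move=> w /= h1 h2; apply: h1 => _; rewrite ger0_norm.
have mXE : measurable_fun setT (EFin \o X) by exact/measurable_EFinP.
have mXn : measurable_fun setT (fun w => (`|X w|)%:E).
  by apply/measurable_EFinP; exact: measurableT_comp.
have i0 : (\int[P]_w (`|X w|)%:E = 0)%E.
  rewrite (@ae_eq_integral _ _ _ P setT (EFin \o X) (fun w => (`|X w|)%:E))//.
  by rewrite -[LHS]fineK ?integrable_fin_num//; congr (_%:E); exact: EX.
have /(ae_eq_integral_abs _ measurableT mXE) aeX :
    (\int[P]_(w in setT) `|(EFin \o X) w| = 0)%E by [].
rewrite (@ae_eq_integral _ _ _ P setT (cst 0%E)) ?integral0//.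
  by apply/measurable_EFinP; exact: measurable_funX.
apply: filterS aeX => w /= h /h [->].
by rewrite expr0n.
Qed.

End sign.

(** Induction on the exceptional points: cut I at t, and bound the value at t by itself. Two points
    on the same side of t never enclose it, so the Lipschitz hypothesis passes to both halves; I is
    an arbitrary subset of [0, 1] to allow this cutting. *)
Lemma piecewise_lipschitz_bounded {R : realType} (sigma : R -> R) (D : seq R) (L : R)
    (I : set R) : (forall x, I x -> 0 <= x <= 1) ->
  (forall x y, I x -> I y ->
    (forall t, t \in D -> ~ (Num.min x y <= t <= Num.max x y)) ->
    `|sigma x - sigma y| <= L * `|x - y|) ->
  exists M, forall x, I x -> `|sigma x| <= M.
Proof.
elim: D I => [|t D IH] I I01 lip.
  have [[x0 Ix0]|nI] := pselect (exists x, I x); last first.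
    by exists 0 => x Ix; case: nI; exists x.
  exists (`|L| + `|sigma x0|) => x Ix.
  have := lip x x0 Ix Ix0 (fun _ => ltac:(by [])).
  have lx : L * `|x - x0| <= `|L|.
    apply: (le_trans (ler_norm _)); rewrite normrM normr_id ler_piMr//.
    have /andP[? ?] := I01 _ Ix; have /andP[? ?] := I01 _ Ix0.
    by rewrite ler_norml; apply/andP; split; lra.
  have := ler_normD (sigma x - sigma x0) (sigma x0).
  by rewrite subrK; lra.
have [||M1 h1] := IH (I `&` [set x | x < t]).
- by move=> x [/I01].
- move=> x y [Ix xt] [Iy yt] hD; apply: lip => // u.
  rewrite inE => /predU1P[->|/hD//] /andP[_].
  by rewrite le_max /= in xt yt *; rewrite leNgt xt /= leNgt yt.
have [||M2 h2] := IH (I `&` [set x | t < x]).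
- by move=> x [/I01].
- move=> x y [Ix xt] [Iy yt] hD; apply: lip => // u.
  rewrite inE => /predU1P[->|/hD//] /andP[+ _].
  by rewrite ge_min /= in xt yt *; rewrite leNgt xt /= leNgt yt.
exists (Num.max (`|sigma t|) (Num.max M1 M2)) => x Ix; rewrite !le_max.
have [xt|xt|->] := ltgtP x t; last by rewrite lexx.
  by rewrite h1// orbT.
by rewrite h2// !orbT.
Qed.

(** * The ratio statistic in the change-point model *)

Section bigmax_nat.
Context {R : realType}.

Lemma bigmax_seq_ge (I : eqType) (r : seq I) (F : I -> R) (i : I) : i \in r ->
  F i <= \big[Num.max/0]_(j <- r) F j.
Proof.
elim: r => // j r IH; rewrite inE big_cons le_max => /predU1P[->|/IH ->].
  by rewrite lexx.
by rewrite orbT.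
Qed.

Lemma bigmax_seq_le (I : eqType) (r : seq I) (F : I -> R) (x : R) : 0 <= x ->
  (forall i, i \in r -> F i <= x) -> \big[Num.max/0]_(j <- r) F j <= x.
Proof.
move=> x0; elim: r => [_|j r IH h]; first by rewrite big_nil.
rewrite big_cons ge_max h ?mem_head//= IH// => i ir.
by apply: h; rewrite inE ir orbT.
Qed.

Lemma bigmax_seq_ge0 (I : eqType) (r : seq I) (F : I -> R) :
  0 <= \big[Num.max/0]_(j <- r) F j.
Proof.
by elim: r => [|j r IH]; rewrite ?big_nil// big_cons le_max IH orbT.
Qed.

Lemma argmax_seqP (f : nat -> R) (s : seq nat) (k : nat) :
  argmax_seq f s k \in k :: s /\
  forall j, j \in k :: s -> f j <= f (argmax_seq f s k).
Proof.
rewrite /argmax_seq; elim: s k => [|i s IH] k /=.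
  by split; [rewrite mem_head|move=> j; rewrite inE => /eqP ->].
have [h1 h2] := IH (if f k < f i then i else k).
split.
  by move: h1; rewrite !inE; case: ifP => _ /orP[->|->]; rewrite ?orbT.
have base : f (if f k < f i then i else k) <= f (foldl (fun best k0 => if f best < f k0 then k0 else best) (if f k < f i then i else k) s).
  by apply: h2; rewrite mem_head.
have kb : f k <= f (if f k < f i then i else k) by case: ifP => // /ltW.
have ib : f i <= f (if f k < f i then i else k).
  by case: ltP => //.
move=> j; rewrite !inE => /or3P[/eqP->|/eqP->|js].
- exact: le_trans base.
- exact: le_trans base.
- by apply: h2; rewrite inE js orbT.
Qed.

End bigmax_nat.

Definition ratio_num {R : realType} (Y : nat -> R) (n k : nat) : R :=
  `| \sum_(1 <= i < k.+1) (Y i - Ybar Y 1 n) |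
   + `| \sum_(n - k + 1 <= i < n.+1) (Y i - Ybar Y 1 n) |.

Definition ratio_den {R : realType} (Y : nat -> R) (n k : nat) : R :=
  \big[Num.max/0]_(1 <= i < k.+1) `| \sum_(1 <= j < i.+1) (Y j - Ybar Y 1 k) |
  + \big[Num.max/0]_(k.+1 <= i < n.+1) `| \sum_(i <= j < n.+1) (Y j - Ybar Y k.+1 n) |.

Lemma ratio_statE {R : realType} (Y : nat -> R) n k :
  ratio_stat Y n k = ratio_num Y n k / ratio_den Y n k.
Proof. by []. Qed.

Lemma ratio_num_ge0 {R : realType} (Y : nat -> R) n k : 0 <= ratio_num Y n k.
Proof. by rewrite addr_ge0. Qed.

Section change_point.
Context {R : realType}.
Variables (mu dl M : R) (z : nat -> R) (n t : nat).

Let Y (k : nat) : R := mu + (if (t < k)%N then dl else 0) + z k.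
Let W (k : nat) : R := \sum_(1 <= j < k.+1) z j.
Let A (k : nat) : R := \sum_(1 <= j < k.+1) Y j.
(** Truncated subtraction makes the drift 0 up to t. The level [mu] is left out because centering
    removes it from every sum of the statistic. *)
Let B (k : nat) : R := dl * (k - t)%:R + W k.

Lemma partial_sumE k : A k = mu * k%:R + B k.
Proof.
rewrite /B /W /A; elim: k => [|k IH].
  by rewrite !big_geq// sub0n !mulr0 !addr0.
rewrite big_nat_recr// [in RHS]big_nat_recr//= IH /Y.
have -> : (k.+1 - t)%:R = (k - t)%:R + (if (t < k.+1)%N then 1 else 0) :> R.
  case: ltnP => h; first by rewrite subSn// natr1.
  by rewrite addr0; congr _%:R; lia.
by rewrite -natr1; case: ifP => _; ring.
Qed.

Lemma head_sumE i k : (0 < k)%N ->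
  \sum_(1 <= j < i.+1) (Y j - Ybar Y 1 k) = B i - i%:R / k%:R * B k.
Proof.
move=> k0; have kn : k%:R != 0 :> R by rewrite pnatr_eq0 -lt0n.
rewrite sumrB sumr_const_nat subn1 /= -mulr_natr /Ybar subn1 /=.
rewrite -/(A i) -/(A k) !partial_sumE.
by field.
Qed.

Lemma tail_sumE i k : (k < i)%N -> (i <= n)%N ->
  \sum_(i <= j < n.+1) (Y j - Ybar Y k.+1 n) =
    (B n - B i.-1) - (n - i.-1)%:R / (n - k)%:R * (B n - B k).
Proof.
move=> ki iN; have k0 : (0 < i)%N by exact: leq_ltn_trans ki.
have kn : (n - k)%:R != 0 :> R by rewrite pnatr_eq0 subn_eq0 -ltnNge; lia.
have AE m : (m < n)%N -> \sum_(m.+1 <= j < n.+1) Y j = A n - A m.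
  move=> mn; rewrite /A (@big_cat_nat _ _ _ m.+1 1 n.+1)//=; last by rewrite ltnS ltnW.
  by rewrite [RHS]addrC addKr.
rewrite sumrB sumr_const_nat -[X in _ - X]mulr_natr /Ybar subSS AE; last by lia.
rewrite -{1}(prednK k0) AE; last by lia.
have -> : (n.+1 - i)%N = (n - i.-1)%N by lia.
have e1 : (n - k)%:R = n%:R - k%:R :> R by rewrite natrB//; lia.
have e2 : (n - i.-1)%:R = n%:R - i.-1%:R :> R by rewrite natrB//; lia.
rewrite !partial_sumE.
rewrite e2; rewrite e1 in kn *; by field.
Qed.

Lemma last_sumE k : (0 < n)%N -> (k <= n)%N ->
  \sum_(n - k + 1 <= j < n.+1) (Y j - Ybar Y 1 n) =
    (B n - B (n - k)) - k%:R / n%:R * B n.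
Proof.
move=> n0 kn; rewrite addn1.
have h := head_sumE n n0; have h' := head_sumE (n - k) n0.
have nn : n%:R != 0 :> R by rewrite pnatr_eq0 -lt0n.
have : \sum_(1 <= j < n.+1) (Y j - Ybar Y 1 n) =
    \sum_(1 <= j < (n - k).+1) (Y j - Ybar Y 1 n) + \sum_((n - k).+1 <= j < n.+1) (Y j - Ybar Y 1 n).
  by rewrite -big_cat_nat// ltnS leq_subr.
rewrite h h' => /esym/(canRL (addKr _)) ->.
by rewrite natrB//; field.
Qed.

Hypothesis n0 : (0 < n)%N.
Hypothesis t0 : (0 < t)%N.
Hypothesis tn : (t < n)%N.
Hypothesis WM : forall k, (k <= n)%N -> `|W k| <= M.

Local Notation N k := (ratio_num Y n k).
Local Notation D k := (ratio_den Y n k).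

Let M0 : 0 <= M.
Proof. exact: le_trans (WM (leq0n n)). Qed.

Let nR : 0 < n%:R :> R.
Proof. by rewrite ltr0n. Qed.

Let frac (i k : nat) (x : R) : (0 < k)%N -> (i <= k)%N -> `|x| <= M ->
  `|i%:R / k%:R * x| <= M.
Proof.
move=> k0 ik xM; rewrite normrM ger0_norm ?divr_ge0//.
rewrite -[leRHS]mul1r ler_pM ?divr_ge0//.
by rewrite ler_pdivrMr ?ltr0n// mul1r ler_nat.
Qed.

Let frac2 (i k : nat) (x : R) : (0 < k)%N -> (i <= k)%N -> `|x| <= 2 * M ->
  `|i%:R / k%:R * x| <= 2 * M.
Proof.
move=> k0 ik xM; rewrite normrM ger0_norm ?divr_ge0//.
rewrite -[leRHS]mul1r ler_pM ?divr_ge0//.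
by rewrite ler_pdivrMr ?ltr0n// mul1r ler_nat.
Qed.

Let itv (i k m : nat) : (0 < k)%N -> (i <= k)%N -> (m <= n)%N ->
  0 <= (i%:R / k%:R * m%:R : R) <= n%:R.
Proof.
move=> k0 ik mn; apply/andP; split; first by rewrite mulr_ge0 ?divr_ge0.
rewrite -[leRHS]mul1r ler_pM ?divr_ge0 ?ler_nat//.
by rewrite ler_pdivrMr ?ltr0n// mul1r ler_nat.
Qed.

Let scaled_le (x y : R) : 0 <= x <= n%:R -> 0 <= y <= n%:R ->
  `|dl * (x - y)| <= `|dl| * n%:R.
Proof.
move=> /andP[x0 x1] /andP[y0 y1]; rewrite normrM ler_wpM2l//.
by rewrite ler_norml; apply/andP; split; lra.
Qed.

(** In each of the two sums the coefficient of [dl] is a difference of two numbers of [0, n]; what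
    remains is 2 + 3 noise terms. *)
Lemma numerator_le k : (k <= n)%N -> N k <= 2 * (`|dl| * n%:R) + 5 * M.
Proof.
move=> kn; rewrite /ratio_num head_sumE// last_sumE// /B.
have h1 : `|dl * (k - t)%:R + W k - k%:R / n%:R * (dl * (n - t)%:R + W n)|
    <= `|dl| * n%:R + 2 * M.
  have -> : dl * (k - t)%:R + W k - k%:R / n%:R * (dl * (n - t)%:R + W n) =
    dl * ((k - t)%:R - k%:R / n%:R * (n - t)%:R) + (W k - k%:R / n%:R * W n) by ring.
  apply: (le_trans (ler_normD _ _)); apply: lerD.
    apply: scaled_le; last exact: itv (leq_subr _ _).
    by rewrite ler0n ler_nat (leq_trans (leq_subr _ _)).
  have := frac n0 kn (WM (leqnn n)); have := WM kn.
  by have := ler_normB (W k) (k%:R / n%:R * W n); lra.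
have h2 : `|dl * (n - t)%:R + W n - (dl * (n - k - t)%:R + W (n - k)%N) -
     k%:R / n%:R * (dl * (n - t)%:R + W n)| <= `|dl| * n%:R + 3 * M.
  have -> : dl * (n - t)%:R + W n - (dl * (n - k - t)%:R + W (n - k)%N) -
     k%:R / n%:R * (dl * (n - t)%:R + W n) =
    dl * (((n - t)%:R - (n - k - t)%:R) - k%:R / n%:R * (n - t)%:R) +
    ((W n - W (n - k)%N) - k%:R / n%:R * W n) by ring.
  apply: (le_trans (ler_normD _ _)); apply: lerD.
    apply: scaled_le; last exact: itv (leq_subr _ _).
    by rewrite -natrB ?ler0n ?ler_nat; lia.
  apply: (le_trans (ler_normB _ _)).
  have := frac n0 kn (WM (leqnn n)).
  have := ler_normB (W n) (W (n - k)%N).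
  have := WM (leqnn n); have := WM (leq_subr k n).
  by lra.
by lra.
Qed.

Lemma numerator_change_ge : `|dl| * (t%:R * (n - t)%:R / n%:R) - 2 * M <= N t.
Proof.
apply: (@le_trans _ _ `| \sum_(1 <= i < t.+1) (Y i - Ybar Y 1 n) |); last first.
  by rewrite /ratio_num lerDl.
rewrite head_sumE// /B subnn mulr0 add0r.
have -> : W t - t%:R / n%:R * (dl * (n - t)%:R + W n) =
   (W t - t%:R / n%:R * W n) - dl * (t%:R * (n - t)%:R / n%:R) by ring.
have h := lerB_dist (dl * (t%:R * (n - t)%:R / n%:R)) (W t - t%:R / n%:R * W n).
have h3 := ler_normB (W t) (t%:R / n%:R * W n).
have h4 := frac n0 (ltnW tn) (WM (leqnn n)).
have h5 := WM (ltnW tn).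
have h6 : `|dl * (t%:R * (n - t)%:R / n%:R)| = `|dl| * (t%:R * (n - t)%:R / n%:R).
  by rewrite normrM [X in _ * X]ger0_norm// divr_ge0 ?mulr_ge0.
rewrite distrC; lra.
Qed.

(** The mean is constant on each side of t, so centering within the two segments cancels the drift;
    2 M of noise is left from the first segment and 4 M from the second. *)
Lemma denominator_change_le : D t <= 6 * M.
Proof.
have h1 : \big[Num.max/0]_(1 <= i < t.+1) `| \sum_(1 <= j < i.+1) (Y j - Ybar Y 1 t) | <= 2 * M.
  apply: bigmax_seq_le => [|i]; first by rewrite mulr_ge0.
  rewrite mem_index_iota ltnS => /andP[i1 it].
  rewrite head_sumE// /B subnn mulr0 add0r.
  have -> : (i - t = 0)%N by lia.
  rewrite mulr0 add0r.
  have h3 := ler_normB (W i) (i%:R / t%:R * W t).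
  have h4 := frac t0 it (WM (ltnW tn)).
  have h5 := WM (leq_trans it (ltnW tn)).
  by lra.
have h2 : \big[Num.max/0]_(t.+1 <= i < n.+1) `| \sum_(i <= j < n.+1) (Y j - Ybar Y t.+1 n) | <= 4 * M.
  apply: bigmax_seq_le => [|i]; first by rewrite mulr_ge0.
  rewrite mem_index_iota ltnS => /andP[ti iN].
  rewrite tail_sumE// /B subnn mulr0 add0r.
  have ntn : (n - t)%:R != 0 :> R by rewrite pnatr_eq0; lia.
  have -> : (n - i.-1)%:R = (n - t)%:R - (i.-1 - t)%:R :> R.
    by rewrite -natrB; [congr _%:R; lia|lia].
  have -> : dl * (n - t)%:R + W n - (dl * (i.-1 - t)%:R + W i.-1) -
     ((n - t)%:R - (i.-1 - t)%:R) / (n - t)%:R * (dl * (n - t)%:R + W n - W t) =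
     (W n - W i.-1) - ((n - t)%:R - (i.-1 - t)%:R) / (n - t)%:R * (W n - W t).
    by field.
  rewrite -natrB; last by lia.
  have h3 := ler_normB (W n - W i.-1) (((n - t - (i.-1 - t))%:R) / (n - t)%:R * (W n - W t)).
  have hn := WM (leqnn n).
  have ht := WM (ltnW tn).
  have hi : `|W i.-1| <= M by apply: WM; lia.
  have h5 := ler_normB (W n) (W i.-1).
  have h6 := ler_normB (W n) (W t).
  have h4 : `|(n - t - (i.-1 - t))%:R / (n - t)%:R * (W n - W t)| <= 2 * M.
    by apply: frac2; [rewrite subn_gt0|exact: leq_subr|lra].
  by lra.
by rewrite /ratio_den; lra.
Qed.

(** If the first maximum vanishes, all centered partial sums up to t vanish, hence so do their
    increments, and z is constant on the first segment. *)
Lemma denominator_change_gt0 j j' : (0 < j <= t)%N -> (0 < j' <= t)%N ->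
  z j < 0 -> 0 < z j' -> 0 < D t.
Proof.
move=> /andP[j0 jt] /andP[j0' jt'] zj zj'.
rewrite /ratio_den; apply: ltr_wpDr; first exact: bigmax_seq_ge0.
rewrite lt_neqAle bigmax_seq_ge0 andbT eq_sym; apply/eqP => mx0.
have S0 i : (i <= t)%N -> \sum_(1 <= j < i.+1) (Y j - Ybar Y 1 t) = 0.
  case: i => [|i] it; first by rewrite big_geq.
  have : `| \sum_(1 <= j < i.+2) (Y j - Ybar Y 1 t) | <= 0.
    rewrite -[leRHS]mx0; apply: (@bigmax_seq_ge _ _ _ (fun i => `| \sum_(1 <= j < i.+1) (Y j - Ybar Y 1 t) |)).
    by rewrite mem_index_iota /= ltnS.
  by rewrite normr_le0 => /eqP.
have Yc i : (0 < i <= t)%N -> Y i = Ybar Y 1 t.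
  case: i => // i /= it; have := S0 i.+1 it.
  by rewrite big_nat_recr//= S0 ?(ltnW it)// add0r => /eqP; rewrite subr_eq0 => /eqP.
have zc i : (0 < i <= t)%N -> z i = Ybar Y 1 t - mu.
  move=> it; rewrite -(Yc i it) /Y ltnNge.
  by have /andP[_ ->] := it; rewrite /= addr0 addrC addKr.
have : z j = z j' by rewrite !zc ?j0 ?j0'.
by lra.
Qed.

(** One of the two segments contains the change, and the tent in it is evaluated at its peak: at i =
    t in the first maximum if t < k, at i = t + 1 in the second if k < t. *)
Lemma denominator_far_ge k : (0 < k <= n)%N -> k != t ->
  `|dl| * (minn t (n - t))%:R * `|k%:R - t%:R| / n%:R - 4 * M <= D k.
Proof.
move=> /andP[k0 kn] kt; set m := minn t (n - t).
have mt : (m <= t)%N by exact: geq_minl.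
have mnt : (m <= n - t)%N by exact: geq_minr.
have [tk|kt'] := ltnP t k.
  have tkn : (t <= n)%N := ltnW tn.
  have h1 : `| \sum_(1 <= j < t.+1) (Y j - Ybar Y 1 k) | <= D k.
    rewrite /ratio_den; apply: ler_wpDr; first exact: bigmax_seq_ge0.
    apply: (@bigmax_seq_ge _ _ _ (fun i => `| \sum_(1 <= j < i.+1) (Y j - Ybar Y 1 k) |)).
    by rewrite mem_index_iota ltnS t0 ltnW.
  apply: le_trans h1; rewrite head_sumE// /B subnn mulr0 add0r.
  have -> : W t - t%:R / k%:R * (dl * (k - t)%:R + W k) =
     (W t - t%:R / k%:R * W k) - dl * (t%:R * (k - t)%:R / k%:R) by ring.
  have h := lerB_dist (dl * (t%:R * (k - t)%:R / k%:R)) (W t - t%:R / k%:R * W k).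
  have h3 := ler_normB (W t) (t%:R / k%:R * W k).
  have h4 := frac k0 (ltnW tk) (WM kn).
  have h5 := WM tkn.
  have h6 : `|dl * (t%:R * (k - t)%:R / k%:R)| = `|dl| * (t%:R * (k - t)%:R / k%:R).
    by rewrite normrM [X in _ * X]ger0_norm// divr_ge0 ?mulr_ge0.
  have h7 : `|dl| * m%:R * `|k%:R - t%:R| / n%:R <= `|dl| * (t%:R * (k - t)%:R / k%:R).
    rewrite -!mulrA ler_wpM2l// -natrB ?(ltnW tk)// normr_nat.
    by rewrite ler_pM ?mulr_ge0 ?invr_ge0 ?ler_nat// ler_wpM2l// lef_pV2 ?posrE ?ltr0n// ler_nat.
  rewrite [leRHS]distrC; apply: le_trans h; rewrite h6; apply: lerB => //.
  by have := M0; lra.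
have {kt kt'} ktl : (k < t)%N by rewrite ltn_neqAle kt.
have h1 : `| \sum_(t.+1 <= j < n.+1) (Y j - Ybar Y k.+1 n) | <= D k.
  rewrite /ratio_den; apply: ler_wpDl; first exact: bigmax_seq_ge0.
  apply: (@bigmax_seq_ge _ _ _ (fun i => `| \sum_(i <= j < n.+1) (Y j - Ybar Y k.+1 n) |)).
  by rewrite mem_index_iota !ltnS tn ltnW.
apply: le_trans h1; rewrite tail_sumE//; last exact: ltnW.
rewrite /B /= subnn mulr0 add0r.
have -> : (k - t = 0)%N by lia.
rewrite mulr0 add0r.
have nkn : (n - k)%:R != 0 :> R by rewrite pnatr_eq0; lia.
have ek : (n - k)%:R = (n - t)%:R + (t - k)%:R :> R by rewrite -natrD; congr _%:R; lia.
have -> : dl * (n - t)%:R + W n - W t - (n - t)%:R / (n - k)%:R * (dl * (n - t)%:R + W n - W k) =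
   ((W n - W t) - (n - t)%:R / (n - k)%:R * (W n - W k)) + dl * ((n - t)%:R * (t - k)%:R / (n - k)%:R).
  by rewrite ek; field; rewrite -ek.
set u := (W n - W t) - _; set v := dl * _.
have h := lerB_dist v (- u); rewrite opprK addrC normrN in h.
have hn := WM (leqnn n).
have ht := WM (ltnW tn).
have hk := WM kn.
have h4 : `|(n - t)%:R / (n - k)%:R * (W n - W k)| <= 2 * M.
  have := ler_normB (W n) (W k).
  move=> ?; apply: frac2; [by rewrite subn_gt0 (ltn_trans ktl)|by rewrite leq_sub2l// ltnW|by lra].
have h3 := ler_normB (W n - W t) ((n - t)%:R / (n - k)%:R * (W n - W k)).
have h5 := ler_normB (W n) (W t).
have h6 : `|v| = `|dl| * ((n - t)%:R * (t - k)%:R / (n - k)%:R).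
  by rewrite normrM [X in _ * X]ger0_norm// divr_ge0 ?mulr_ge0.
have h7 : `|dl| * m%:R * `|k%:R - t%:R| / n%:R <= `|dl| * ((n - t)%:R * (t - k)%:R / (n - k)%:R).
  rewrite -!mulrA ler_wpM2l// distrC -natrB ?(ltnW ktl)// normr_nat.
  rewrite ler_pM ?mulr_ge0 ?invr_ge0 ?ler_nat// ler_wpM2l// lef_pV2 ?posrE ?ltr0n ?ler_nat ?leq_subr//.
  by rewrite subn_gt0 (ltn_trans ktl).
have hu : `|u| <= 4 * M by rewrite /u; lra.
apply: (le_trans (lerB h7 hu)); rewrite -h6.
by rewrite addrC [u + v]addrC.
Qed.

End change_point.

(** * Consistency *)

(** With D = |dl| n, the ratio at k is at most 3 D / (D kap / 2) and the one at t at least (D q / 2)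
    / (6 M). The constant 100 leaves room in the cross product: 18/100 against 25/100 of D^2 q
    kap. *)
Lemma ratio_far_lt {R : realType} (mu dl M q kap c : R) (z : nat -> R) (n t k j j' : nat) :
  (0 < t)%N -> (t < n)%N -> (0 < k <= n)%N ->
  (forall k, (k <= n)%N -> `|\sum_(1 <= j < k.+1) z j| <= M) ->
  (0 < j <= t)%N -> (0 < j' <= t)%N -> z j < 0 -> 0 < z j' ->
  dl != 0 -> 0 < q <= 1 -> 0 < kap ->
  M <= c * (`|dl| * n%:R) -> c <= q / 100 -> c <= q * kap / 100 ->
  n%:R * q <= (minn t (n - t))%:R -> n%:R * q <= t%:R * (n - t)%:R / n%:R ->
  kap <= q * (`|k%:R - t%:R| / n%:R) ->
  ratio_stat (fun k => mu + (if (t < k)%N then dl else 0) + z k) n k <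
  ratio_stat (fun k => mu + (if (t < k)%N then dl else 0) + z k) n t.
Proof.
move=> t0 tn kn WM jt jt' zj zj' dl0 /andP[q0 q1] kap0 Mc cq cqk mq tq kq.
have n0 : (0 < n)%N by exact: leq_ltn_trans tn.
have nR : 0 < n%:R :> R by rewrite ltr0n.
have kt : k != t.
  by apply/eqP => kt; move: kq; rewrite kt subrr normr0 mul0r mulr0 leNgt kap0.
have M0 : 0 <= M := le_trans (normr_ge0 _) (WM 0%N (leq0n n)).
have /andP[k0 kn'] := kn.
have hN := numerator_le mu dl n0 t0 tn WM kn'.
have hNt := numerator_change_ge mu dl n0 tn WM.
have hDt := denominator_change_le mu dl n0 t0 tn WM.
have hDt0 := denominator_change_gt0 mu dl n jt jt' zj zj'.
have hDk := denominator_far_ge mu dl n0 t0 tn WM kn kt.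
have D0 : 0 < `|dl| * n%:R by rewrite mulr_gt0// normr_gt0.
have e1 : `|dl| * n%:R * q <= `|dl| * (t%:R * (n - t)%:R / n%:R).
  by rewrite -mulrA ler_wpM2l.
have e2 : `|dl| * n%:R * kap <= `|dl| * (minn t (n - t))%:R * `|k%:R - t%:R| / n%:R.
  rewrite -!mulrA ler_wpM2l//; apply: (@le_trans _ _ (n%:R * (q * (`|k%:R - t%:R| / n%:R)))).
    by rewrite ler_wpM2l// ltW.
  by rewrite mulrA ler_wpM2r// divr_ge0.
rewrite !ratio_statE.
move: hN hNt hDt hDt0 hDk e1 e2 Mc D0.
have := ratio_num_ge0 (fun k => mu + (if (t < k)%N then dl else 0) + z k) n k.
set Nk := ratio_num _ n k; set Dk := ratio_den _ n k.
set Nt := ratio_num _ n t; set Dt := ratio_den _ n t.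
set D := `|dl| * n%:R.
set x1 := `|dl| * _; set x2 := `|dl| * _ * _ / _.
move=> Nk0 hN hNt hDt hDt0 hDk e1 e2 Mc D0.
have cD1 : c * D <= D * q / 100.
  have : c * D <= q / 100 * D by rewrite ler_wpM2r// ltW.
  by lra.
have cD2 : c * D <= D * kap / 100 * q.
  have : c * D <= q * kap / 100 * D by rewrite ler_wpM2r// ltW.
  by lra.
have Dq : D * q <= D by rewrite ler_piMr// ltW.
have Dk0 : 0 < D * kap by rewrite mulr_gt0.
have Dkq : D * kap * q <= D * kap by rewrite ler_piMr// ltW.
have hDkl : D * kap / 2 <= Dk by lra.
have hDk0 : 0 < Dk by lra.
have hNk : Nk <= 3 * D by lra.
have hNtl : D * q / 2 <= Nt by lra.
rewrite ltr_pdivrMr// mulrAC ltr_pdivlMr//.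
apply: (@le_lt_trans _ _ (3 * D * (6 * M))).
  by rewrite ler_pM// ltW.
apply: (@lt_le_trans _ _ (D * q / 2 * (D * kap / 2))); last first.
  by rewrite ler_pM// ?divr_ge0// ?mulr_ge0// ltW.
have h1 : M <= D * kap * q / 100 by lra.
have h2 : 3 * D * (6 * M) <= 3 * D * (6 * (D * kap * q / 100)).
  have D3 : 0 <= 3 * D by rewrite mulr_ge0// ltW.
  by rewrite ler_wpM2l// ler_wpM2l.
apply: (le_lt_trans h2).
have -> : 3 * D * (6 * (D * kap * q / 100)) = D * q * (D * kap) * (18 / 100) by ring.
have -> : D * q / 2 * (D * kap / 2) = D * q * (D * kap) * (25 / 100) by field.
by rewrite (ltr_pM2l (mulr_gt0 (mulr_gt0 D0 q0) Dk0)) ltr_pM2r ?invr_gt0// ltr_nat.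
Qed.

(** Since 2 <= n zeta, rounding leaves t >= n zeta / 2, and n - t >= n (1 - zeta) always; q bounds
    min(t, n - t) / n and t (n - t) / n^2 from below. The separation [q * eps / 2] allows half of
    eps for the distance, at most 1, between t and n zeta. *)
Lemma tauhat_close {R : realType} (mu dl M c zeta eps : R) (z : nat -> R) (n j j' : nat) :
  let t := tau zeta n in
  let q := zeta * (1 - zeta) / 2 in
  0 < zeta < 1 -> 0 < eps ->
  2 <= n%:R * zeta -> 2 <= n%:R * eps ->
  (forall k, (k <= n)%N -> `|\sum_(1 <= j < k.+1) z j| <= M) ->
  (0 < j <= t)%N -> (0 < j' <= t)%N -> z j < 0 -> 0 < z j' ->
  dl != 0 ->
  M <= c * (`|dl| * n%:R) -> c <= q / 100 -> c <= q * (q * eps / 2) / 100 ->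
  `|(tauhat (fun k => mu + (if (t < k)%N then dl else 0) + z k) n)%:R / n%:R - zeta| < eps.
Proof.
move=> t q /andP[z0 z1] e0 nz ne WM jt jt' zj zj' dl0 Mc cq cqk.
have nR : 0 < n%:R :> R.
  by rewrite lt_neqAle ler0n andbT eq_sym; apply: contraTneq nz => ->; rewrite mul0r -ltNge.
have n0 : (0 < n)%N by rewrite ltr0n in nR.
have nz0 : 0 <= n%:R * zeta by rewrite mulr_ge0// ltW.
have /andP[t1 t2] := truncn_itv nz0; rewrite -[Num.truncn _]/t in t1 t2.
rewrite -natr1 in t2.
have nzn : n%:R * zeta < n%:R by rewrite -[ltRHS]mulr1 ltr_pM2l.
have tn : (t < n)%N by rewrite -(ltr_nat R); exact: le_lt_trans nzn.
have t0 : (0 < t)%N by rewrite -(ltr_nat R); lra.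
have ntE : (n - t)%:R = n%:R - t%:R :> R by rewrite natrB// ltnW.
have q0 : 0 < q by rewrite divr_gt0// mulr_gt0// subr_gt0.
have zz1 : zeta * (1 - zeta) <= zeta by rewrite ler_piMr ?(ltW z0)// lerBlDr lerDl ltW.
have zz2 : zeta * (1 - zeta) <= 1 - zeta by rewrite ler_piMl ?(ltW z1)// subr_ge0 ltW.
have q1 : q <= zeta / 2 by rewrite /q; lra.
have q2 : q <= 1 - zeta by rewrite /q; lra.
have nq1 : n%:R * q <= n%:R * (zeta / 2) by rewrite ler_pM2l.
have nq2 : n%:R * q <= n%:R * (1 - zeta) by rewrite ler_pM2l.
have tl : n%:R * (zeta / 2) <= t%:R by lra.
have ntl : n%:R * (1 - zeta) <= (n - t)%:R by rewrite ntE; lra.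
have [h1 h2] := argmax_seqP (ratio_stat (fun k => mu + (if (t < k)%N then dl else 0) + z k) n)
  (iota 2 n.-1) 1.
rewrite -/(tauhat _ n) in h1 h2.
set k := tauhat _ n in h1 h2 *.
have io : 1%N :: iota 2 n.-1 = iota 1 n by rewrite -{2}(prednK n0).
rewrite io mem_iota add1n ltnS in h1.
rewrite ltNge; apply/negP => far.
have tin : t \in 1%N :: iota 2 n.-1 by rewrite io mem_iota add1n ltnS t0 ltnW.
have := h2 t tin; apply/negP; rewrite -ltNge.
apply: (@ratio_far_lt R mu dl M q (q * eps / 2) c z n t k j j') => //.
- by rewrite q0 /=; lra.
- by rewrite divr_gt0// mulr_gt0.
- by rewrite /minn; case: ifP => _; lra.
- rewrite ler_pdivlMr// -mulrA.
  have -> : n%:R * (q * n%:R) = (n%:R * (zeta / 2)) * (n%:R * (1 - zeta)) by rewrite /q; field.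
  by rewrite ler_pM// ?mulr_ge0// ?divr_ge0 ?subr_ge0// ltW.
- rewrite -mulrA ler_wpM2l ?(ltW q0)// ler_pdivlMr//.
  have e1 : k%:R / n%:R - zeta = (k%:R - n%:R * zeta) / n%:R by field; rewrite gt_eqF.
  rewrite e1 normrM [X in _ * X]ger0_norm ?invr_ge0// ler_pdivlMr// in far.
  have := ler_distD t%:R k%:R (n%:R * zeta).
  have : `|t%:R - n%:R * zeta| <= 1 by rewrite ler_norml; apply/andP; split; lra.
  by lra.
Qed.

(** * Measurability of the estimator *)

Section measurability.
Context {d : measure_display} {T : measurableType d} {R : realType}.
Local Notation mf f := (measurable_fun setT f).

Lemma measurable_bigmax (I : Type) (r : seq I) (F : I -> T -> R) :
  (forall i, mf (F i)) -> mf (fun w => \big[Num.max/0]_(i <- r) F i w).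
Proof.
move=> mF; elim: r => [|i r IH].
  by under eq_fun do rewrite big_nil; exact: measurable_cst.
by under eq_fun do rewrite big_cons; exact: measurable_maxr.
Qed.

(** On nonnegative reals, 0 included, the inverse is the power of exponent -1. *)
Lemma measurable_div_ge0 (f g : T -> R) : mf f -> mf g -> (forall w, 0 <= g w) ->
  mf (fun w => f w / g w).
Proof.
move=> mf mg g0; under eq_fun do rewrite -powR_inv1//.
apply: measurable_funM => //.
by apply: (measurableT_comp (@measurable_powR R (-1))).
Qed.

Lemma measurable_ratio_stat (Y : nat -> T -> R) (n k : nat) :
  (forall i, mf (Y i)) -> mf (fun w => ratio_stat (Y ^~ w) n k).
Proof.
move=> mY.
have mbar a b : mf (fun w => Ybar (Y ^~ w) a b).
  by apply: measurable_funM => //; exact: measurable_sum.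
have mS a b a' b' : mf (fun w => `|\sum_(a <= j < b) (Y j w - Ybar (Y ^~ w) a' b')|).
  apply: measurableT_comp => //; apply: measurable_sum => j.
  by apply: measurable_funB.
apply: measurable_div_ge0.
- by apply: measurable_funD; exact: mS.
- apply: measurable_funD; apply: measurable_bigmax => i; exact: mS.
- by move=> w; rewrite addr_ge0// bigmax_seq_ge0.
Qed.

(** The current best index is random, so the induction is over a random start g; comparisons at g
    are split over its countably many values. *)
Lemma measurable_argmax (f : nat -> T -> R) (s : seq nat) (g : T -> nat) :
  (forall k, mf (f k)) -> (forall j, measurable [set w | g w = j]) ->
  forall j, measurable [set w | argmax_seq (f ^~ w) s (g w) = j].
Proof.
move=> mf; elim: s g => [//|k s IH] g mg j.
apply: (IH (fun w => if f (g w) w < f k w then k else g w)) => i.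
have mlt : measurable [set w | f (g w) w < f k w].
  rewrite (_ : [set w | _] = \bigcup_i ([set w | g w = i] `&` [set w | 0 < f k w - f i w])).
    apply: bigcupT_measurable => l; apply: measurableI => //.
    by apply: measurable_gt; exact: measurable_funB.
  apply/seteqP; split => [w h|w [l _ [/= <-]]]; last by rewrite subr_gt0.
  by exists (g w) => //; split => //=; rewrite subr_gt0.
rewrite (_ : [set w | _] =
   ([set w | f (g w) w < f k w] `&` [set w | k = i]) `|`
   (~` [set w | f (g w) w < f k w] `&` [set w | g w = i])).
  apply: measurableU; apply: measurableI => //; last exact: measurableC.
  have [->|ki] := pselect (k = i).
    by rewrite (_ : [set w | _] = setT)//; apply/seteqP; split.
  by rewrite (_ : [set w | _] = set0)//; apply/seteqP; split.
apply/seteqP; split => w /=; case: ifPn => h.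
- by move=> ->; left.
- by move=> ->; right; split => //; exact/negP.
- by move=> [[_ ->]|[]].
- by move=> [[]|[_ ->]] //; rewrite (negbTE h).
Qed.

(* Needed because a measure is unspecified on non-measurable sets. *)
Lemma measurable_tauhat_set (Y : nat -> T -> R) (n : nat) (S : set nat) :
  (forall i, mf (Y i)) -> measurable [set w | S (tauhat (Y ^~ w) n)].
Proof.
move=> mY; rewrite (_ : [set w | _] = \bigcup_(j in S) [set w | tauhat (Y ^~ w) n = j]).
  apply: bigcup_measurable => j _.
  apply: (@measurable_argmax (fun k w => ratio_stat (Y ^~ w) n k) _ (fun=> 1%N)).
    by move=> k; exact: measurable_ratio_stat.
  move=> i; have [->|ki] := pselect (1%N = i).
    by rewrite (_ : [set w | _] = setT)//; apply/seteqP; split.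
  by rewrite (_ : [set w | _] = set0)//; apply/seteqP; split.
by apply/seteqP; split => [w Sw|w [j Sj /= ->]//]; exists (tauhat (Y ^~ w) n).
Qed.

End measurability.

Theorem theorem4 (d : measure_display) (T : measurableType d) (R : realType)
  (P : probability T R) (e : nat -> {RV P >-> R})
  (sigma : R -> R) (mu : R) (delta : nat -> R) (zeta : R) :
  assumption_E e -> assumption_V sigma -> assumption_C delta ->
  0 < zeta < 1 ->
  (forall n, delta n != 0) ->
  forall eps : R, 0 < eps ->
    (fun n : nat => P [set w | eps <= `| (tauhat (fun k => Ymodel mu delta zeta sigma (fun k => e k) n k w) n)%:R / n%:R - zeta |])
      @ \oo --> 0%E.
Proof.
move=> [stat [mean0 [var1 [[p [p2 [Ep_fin [r [r2 [_ [rp cr]]]]]]] [ca _]]]]].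
move=> [sigma_gt0 [D [L lip]]] dC zeta01 delta0 eps eps0.
have p0 : 0 < p by exact: lt_trans p2.
have r0 : 0 < r by exact: lt_trans r2.
pose h (x : R) := `|x| `^ p.
have h0 x : 0 <= h x by exact: powR_ge0.
have mh : measurable_fun setT h.
  by apply: (measurableT_comp (@measurable_powR R p)).
have ip0 : P.-integrable setT (EFin \o (h \o e 0%N)).
  apply/integrableP; split.
    by apply/measurable_EFinP; exact: measurableT_comp.
  move: Ep_fin; rewrite unlock; apply: le_lt_trans.
  rewrite le_eqVlt; apply/orP; left; apply/eqP.
  by apply: eq_integral => x _ /=; rewrite ger0_norm.
have ip i := integ_stationary stat i mh h0 ip0.
pose A := Rintegral P setT (h \o e 0%N).
have Ep i : Rintegral P setT (fun w => h (e i w)) <= A.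
  by rewrite (E_stationary stat i mh h0).
have iX i : P.-integrable setT (EFin \o e i).
  by apply: (@integ_dom1 _ _ _ P e p p2 ip _ i).
have E0 i : Rintegral P setT (e i) = 0.
  by have := mean0 i; rewrite unlock /Rintegral => ->.
have E2 : (\int[P]_w (e 0%N w ^+ 2)%:E != 0)%E.
  have := var1 0%N; rewrite /variance unlock unlock => v1.
  rewrite (_ : (\int[P]_w _)%E = 1%E) ?oner_eq0//.
  rewrite -[RHS]v1; apply: eq_integral => w _ /=.
  have -> : (\int[P]_x (e 0%N x)%:E)%E = 0%E by have := mean0 0%N; rewrite unlock.
  by rewrite !fctE /= subr0 expr2.
pose al := alpha_mix P (fun k => e k).
pose q1 := 1 - 2 / p.
have q10 : 0 < q1 by rewrite subr_gt0 ltr_pdivrMr// mul1r.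
pose g := 2 * (r^-1 - p^-1).
have g0 : 0 <= g by rewrite mulr_ge0// subr_ge0 lef_pV2.
have gq : g < q1.
  have : r^-1 < 2^-1 by rewrite ltf_pV2 ?posrE.
  by rewrite /g /q1; lra.
(* The solution of (1 - 2/p)(1 - t) = g, so that the series needed below is the one assumed
   convergent. *)
pose t := 1 - g / q1.
have t0 : 0 < t by rewrite subr_gt0 ltr_pdivrMr// mul1r.
have t1 : t <= 1 by rewrite gerBl divr_ge0// ltW.
have qt : (1 - 2 / p) * (1 - t) = g.
  by rewrite -/q1 /t; field; rewrite gt_eqF.
pose S := limn (series (fun n => al n `^ g)).
have aS n : \sum_(0 <= k < n) al k `^ ((1 - 2 / p) * (1 - t)) <= S.
  rewrite qt -[leLHS]/(series (fun n => al n `^ g) n).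
  apply: nondecreasing_cvgn_le => //.
  by apply: nondecreasing_series => k _ _; exact: powR_ge0.
have [Ca Ca0 a2] := alpha_quadratic ca.
have [K sK] : exists K, forall x, 0 <= x <= 1 -> `|sigma x| <= K.
  by apply: (@piecewise_lipschitz_bounded R sigma D L [set x | 0 <= x <= 1]).
have K0 : 0 <= K by apply: le_trans (sK 0 _); rewrite ?lexx ?ler01.
(* Weights indexed from 0 like [e]; the default 0 keeps them bounded where the argument of [sigma]
   would leave [0, 1]. *)
pose s n k := if (k < n)%N then sigma (k.+1%:R / n%:R) else 0.
have s01 n k : (k < n)%N -> 0 <= (k.+1%:R / n%:R : R) <= 1.
  move=> kn; rewrite divr_ge0//= ler_pdivrMr ?mul1r ?ler_nat//.
  by rewrite ltr0n (leq_ltn_trans _ kn).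
have sb n k : `|s n k| <= K.
  by rewrite /s; case: ifPn => [/s01/sK//|_]; rewrite normr0.
have /andP[z0 z1] := zeta01.
pose q := zeta * (1 - zeta) / 2.
have q0 : 0 < q by rewrite divr_gt0// mulr_gt0// subr_gt0.
pose c := Num.min (q / 100) (q * (q * eps / 2) / 100).
have c0 : 0 < c.
  have k0 : 0 < q * eps / 2 by apply: divr_gt0 => //; exact: mulr_gt0.
  by rewrite lt_min; apply/andP; split; apply: divr_gt0 => //; exact: mulr_gt0.
have cq1 : c <= q / 100 by rewrite ge_min lexx.
have cq2 : c <= q * (q * eps / 2) / 100 by rewrite ge_min lexx orbT.
have me i : measurable_fun setT (e i) by [].
(* A noise path that stays in neither set up to the change takes a strictly negative and a strictly
   positive value there, as [denominator_change_gt0] requires. *)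
pose Bp : set R := [set x | 0 <= x]; pose Bn : set R := [set x | 0 <= - x].
have mBp : measurable Bp by exact: measurable_ge.
have mBn : measurable Bn by apply: measurable_ge; exact: oppr_measurable.
have pB1 : fine (P (e 0%N @^-1` Bp)) < 1 by exact: (pr_ge0_lt1 (iX 0%N) (E0 0%N) E2).
have pB2 : fine (P (e 0%N @^-1` Bn)) < 1.
  have iN : P.-integrable setT (EFin \o (fun w => - e 0%N w)).
    by have := integZ (-1) (iX 0%N); under eq_fun do rewrite mulN1r.
  apply: (pr_ge0_lt1 iN); last by under eq_integral do rewrite sqrrN.
  have := EZ (-1) (iX 0%N); rewrite E0 mulr0 => <-.
  by congr (Rintegral _ _ _); apply/funext => w; rewrite mulN1r.
pose Y n k w := Ymodel mu delta zeta sigma (fun k => e k) n k w.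
have mY n k : measurable_fun setT (Y n k).
  by apply: measurable_funD => //; exact: measurable_funM.
pose F n := [set w | eps <= `|(tauhat (fun k => Y n k w) n)%:R / n%:R - zeta|].
have mF n : measurable (F n).
  exact: (@measurable_tauhat_set _ _ _ (Y n) n
    [set j | eps <= `|j%:R / n%:R - zeta|] (mY n)).
suff main : forall eta, 0 < eta -> exists N, forall n, (N <= n)%N -> fine (P (F n)) <= eta.
  apply/fine_cvgP; split; first by near=> n; rewrite fin_num_measure//; exact: mF.
  apply/cvgrPdist_le => eta eta0; have [N hN] := main eta eta0.
  exists N => // n /= Nn; rewrite sub0r normrN ger0_norm ?pr_ge0//.
  exact: hN.
move=> eta eta0; have eta3 : 0 < eta / 3 by rewrite divr_gt0.
have [N1 hN1] := noise_negligible p2 ip Ep E0 t0 t1 aS a2 dC sb c0 eta3.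
have [N2 hN2] := pr_all_in a2 stat mBp pB1 eta3.
have [N3 hN3] := pr_all_in a2 stat mBn pB2 eta3.
(* N4 and N5 make n zeta and n eps at least 2; N6 makes the change point large enough for both
   persistence bounds. *)
pose N4 := (Num.truncn (2 / zeta)).+1.
pose N5 := (Num.truncn (2 / eps)).+1.
pose N6 := (Num.truncn ((maxn N2 N3).+1%:R / zeta)).+1.
exists (maxn (maxn N1 N4) (maxn N5 N6)) => n.
rewrite !geq_max => /andP[/andP[n1 n4] /andP[n5 n6]].
have big x y N : 0 < y -> N = (Num.truncn (x / y)).+1 -> (N <= n)%N -> x <= n%:R * y :> R.
  move=> y0 -> Nn; rewrite -ler_pdivrMr//; apply: (le_trans (ltW (truncnS_gt _))).
  by rewrite ler_nat.
have nz := big _ _ _ z0 erefl n4.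
have ne := big _ _ _ eps0 erefl n5.
have nt := big _ _ _ z0 erefl n6.
have tN : (maxn N2 N3 <= tau zeta n)%N.
  rewrite /tau truncn_ge_nat; last by rewrite mulr_ge0// ltW.
  by apply: le_trans nt; rewrite ler_nat.
have tn : (tau zeta n <= n)%N.
  rewrite /tau -(ler_nat R); apply: (@le_trans _ _ (n%:R * zeta)).
    by rewrite truncn_le mulr_ge0// ltW.
  by rewrite ler_piMr// ltW.
have [y0 bad1] := hN1 n n1.
move: tN; rewrite geq_max => /andP[/hN2 bad2 /hN3 bad3].
set y := c * (`|delta n| * n%:R) in y0 bad1.
set U := \big[setU/set0]_(i < n.+1) _ in bad1.
have mU : measurable U.
  apply: bigsetU_measurable => i _; apply: measurable_gt.
  apply: measurableT_comp => //; apply: measurable_sum => k.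
  exact: measurable_funM.
have mI B : measurable B -> measurable (all_in e B (tau zeta n)).
  by move=> mB; exact: measurable_all_in.
have sub : F n `<=` U `|` (all_in e Bp (tau zeta n) `|` all_in e Bn (tau zeta n)).
  move=> w Fw; apply: contrapT => /not_orP[nU /not_orP[nP nN]].
  have [j /not_implyP[jt /negP ej]] := (existsNP _).2 nP.
  have [j' /not_implyP[jt' /negP ej']] := (existsNP _).2 nN.
  move: ej ej'; rewrite -!ltNge oppr_lt0 => ej ej'.
  have spos i : (i < n)%N -> 0 < sigma (i.+1%:R / n%:R).
    by move=> /s01; exact: sigma_gt0.
  move: Fw; apply/negP; rewrite -ltNge.
  apply: (@tauhat_close R mu (delta n) y c zeta eps
    (fun k => sigma (k%:R / n%:R) * e k.-1 w) n j.+1 j'.+1) => //.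
  - move=> k kn; rewrite leNgt; apply/negP => yk; apply: nU.
    rewrite /U -(bigcup_mkord _ (fun i => [set w | y < `|\sum_(0 <= k < i) s n k * e k w|])).
    exists k => /=; first by rewrite ltnS.
    move: yk; rewrite big_add1 /=; congr (_ < `|_|).
    rewrite big_nat [RHS]big_nat; apply: eq_bigr => i /andP[_ ik].
    by rewrite /s (leq_trans ik kn).
  - by rewrite /= pmulr_rlt0// spos// (leq_trans jt).
  - by rewrite /= pmulr_rgt0// spos// (leq_trans jt').
have mW : measurable (all_in e Bp (tau zeta n) `|` all_in e Bn (tau zeta n)).
  by apply: measurableU; exact: mI.
apply: (le_trans (pr_le P (mF n) (measurableU _ _ mU mW) sub)).
apply: (le_trans (pr_leU P mU mW)).
rewrite (_ : eta = eta / 3 + (eta / 3 + eta / 3)); last by field.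
apply: lerD bad1 _; apply: (le_trans (pr_leU P (mI _ mBp) (mI _ mBn))).
exact: lerD.
Unshelve. all: by end_near. Qed.
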